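(* Let $V=\mathbb R^{p,q}$ with $p+q\ge 1$, and put $n=p+q$, $s=p-q$. The pair $(L^+,L^-)$ and, when $S$ is reducible, the quadruple $(L^{++},L^{+-},L^{-+},L^{--})$ (defined in the context) depend only on $n$ modulo 8 and $s$ modulo 8. Regarded as functions of $(n,s)$ modulo 8 they satisfy the mirror supersymmetry $$L^+(-n,s)=L^-(n,s),\qquad L^{+\,\iota_0}(-n,s)=L^{-\,\iota_0}(n,s)\quad(\iota_0=\pm).$$ Their values, with $n$ and $s$ read modulo 8 (always $n\equiv s \bmod 2$), are as follows. The quadruples $(L^{++},L^{+-},L^{-+},L^{--})(n,s)$, in the cases where $S$ is reducible: - $s=4$: $(2,0,6,0)$ for $n=-2$; $(0,4,0,4)$ for $n=0$; $(6,0,2,0)$ for $n=2$; $(0,4,0,4)$ for $n=4$. - $s=2$: $(0,2,4,2)$ for $n=-2$; $(2,2,2,2)$ for $n=0$; $(4,2,0,2)$ for $n=2$; $(2,2,2,2)$ for $n=4$. - $s=1$: $(0,1,2,1)$ for $n=-3$ and $n=-1$; $(2,1,0,1)$ for $n=1$ and $n=3$. - $s=0$: $(0,0,2,0)$ for $n=-2$; $(0,1,0,1)$ for $n=0$; $(2,0,0,0)$ for $n=2$; $(0,1,0,1)$ for $n=4$. The pairs $(L^+,L^-)(n,s)$, in the cases where $S$ is irreducible: - $s=3$: $(1,3)$ for $n=-3$ and $n=-1$; $(3,1)$ for $n=1$ and $n=3$. - $s=-1$: $(0,1)$ for $n=-3$ and $n=-1$; $(1,0)$ for $n=1$ and $n=3$.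 - $s=-2$: $(0,2)$ for $n=-2$; $(1,1)$ for $n=0$; $(2,0)$ for $n=2$; $(1,1)$ for $n=4$. - $s=-3$: $(1,3)$ for $n=-3$ and $n=-1$; $(3,1)$ for $n=1$ and $n=3$. When $S$ is reducible, $L^{+}=L^{++}+L^{+-}$ and $L^-=L^{-+}+L^{--}$.
   Context: $V=\mathbb R^{p,q}$ carries $\langle x,y\rangle=\sum_{i\le p}x^iy^i-\sum_{p<j\le p+q}x^jy^j$. $C\ell(V)=C\ell^0(V)+C\ell^1(V)$ is its Clifford algebra with the convention $v^2=-\langle v,v\rangle$. The spinor module $S$ is an irreducible real $C\ell(V)$-module, viewed as a module of $\mathfrak{so}(V)\subset C\ell^0(V)$ and of $C\ell^0(V)$; $S$ is called reducible if it is reducible over $C\ell^0(V)$, and then $S=S^++S^-$ with irreducible $C\ell^0(V)$-submodules $S^\pm$, chosen such that $S^-=C\ell^1(V)S^+$. $\mathcal J$ is the real vector space of $\mathfrak{so}(V)$-equivariant linear maps $j:V\to (S\otimes S)^*$ (values are bilinear forms on $S$). $\mathcal J^{+}$ (resp. $\mathcal J^-$) is the subspace of $j$ such that all forms $j(v)$ are symmetric (resp. skew symmetric). If $S=S^++S^-$ is reducible, $\mathcal J^{\sigma_0 +}\subset\mathcal J^{\sigma_0}$ is the subspace of those $j$ with $j(V)\subset(S^+\otimes S^++S^-\otimes S^-)^*$ (i.e. $S^+$ and $S^-$ are orthogonal for every $j(v)$), and $\mathcal J^{\sigma_0 -}\subset\mathcal J^{\sigma_0}$ is the subspace of those $j$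 for which $S^+$ and $S^-$ are both isotropic for every $j(v)$. Put $L^{\sigma_0}=\dim\mathcal J^{\sigma_0}$ and $L^{\sigma_0\iota_0}=\dim\mathcal J^{\sigma_0\iota_0}$. ($L^+$ is the maximal number of linearly independent super Lie algebra structures, and $L^-$ of $\mathbb Z_2$-graded Lie algebra structures, on $\mathfrak p(V)+S$ extending the Poincaré algebra $\mathfrak p(V)=\mathfrak{so}(V)+V$, with $V$ acting trivially on $S$ and brackets of $S$ with $S$ in $V$.) *)

(* Defs.v *)
From HB Require Import structures.
From mathcomp Require Import all_boot all_order all_algebra all_field.
From mathcomp Require Import ring boolp reals.
From mathcomp Require classical_sets.

Set Implicit Arguments.
Unset Strict Implicit.
Unset Printing Implicit Defensive.

Import Order.TTheory GRing.Theory Num.Theory.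

Local Open Scope ring_scope.

Section QuadraticSpace.
Context (R : realType) (p q : nat).

Definition pq_form (x y : 'rV[R]_(p + q)) : R :=
  \sum_(i : 'I_(p + q) | (i < p)%N) x 0 i * y 0 i
  - \sum_(j : 'I_(p + q) | (p <= j)%N) x 0 j * y 0 j.

Definition std_basis (i : 'I_(p + q)) : 'rV[R]_(p + q) := delta_mx 0 i.

Definition in_so (a : 'End('rV[R]_(p + q))) : Prop :=
  forall x y, pq_form (a x) y + pq_form x (a y) = 0.

Definition pq_sign (i : 'I_(p + q)) : R := (-1) ^+ (p <= i)%N.

Lemma pq_formE x y : pq_form x y = \sum_i pq_sign i * (x 0 i * y 0 i).
Proof.
rewrite /pq_form [RHS](bigID (fun i : 'I__ => (i < p)%N)) /= -sumrN.
congr (_ + _); first by apply: eq_bigr => i ip; rewrite /pq_sign leqNgt ip mul1r.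
apply: eq_big => i; first by rewrite leqNgt.
by rewrite /pq_sign => ->; rewrite expr1 mulN1r.
Qed.

Lemma pq_formC x y : pq_form x y = pq_form y x.
Proof. by rewrite !pq_formE; apply: eq_bigr => i _; rewrite (mulrC (x 0 i)). Qed.

Lemma pq_form_linearl y : scalar (pq_form^~ y).
Proof.
move=> a u v; rewrite !pq_formE (mulr_sumr _ _ _ a) -big_split /=; apply: eq_bigr => i _.
by rewrite !mxE mulrDl mulrDr -mulrA (mulrCA _ a).
Qed.

Lemma pq_form_basisl i x : pq_form (std_basis i) x = pq_sign i * x 0 i.
Proof.
rewrite pq_formE (bigD1 i) //= big1 ?addr0; first by rewrite mxE !eqxx mul1r.
by move=> j /negPf ji; rewrite mxE ji andbF mul0r mulr0.
Qed.

Lemma pq_signK i : pq_sign i * pq_sign i = 1.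
Proof. by rewrite -expr2 sqrr_sign. Qed.

Lemma pq_expand x : x = \sum_i (pq_sign i * pq_form (std_basis i) x) *: std_basis i.
Proof.
rewrite [LHS]row_sum_delta; apply: eq_bigr => i _.
by rewrite pq_form_basisl mulrA pq_signK mul1r.
Qed.

End QuadraticSpace.

(* The Clifford algebra, given by its basis e_A, A a set of indices, where e_A
   is the product of the e_i for i in A in increasing order. Reordering
   e_A e_B costs a sign for each pair a in A, b in B with b < a, and a sign for
   each common index i with e_i ^ 2 = - <e_i, e_i> = -1, that is i < p. *)
Definition clifford (R : realType) (p q : nat) : Type :=
  {ffun {set 'I_(p + q)} -> R^o}.

HB.instance Definition _ (R : realType) (p q : nat) :=
  Vector.copy (clifford R p q) {ffun {set 'I_(p + q)} -> R^o}.

Section CliffordAlgebra.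
Context (R : realType) (p q : nat).
Local Notation I := 'I_(p + q).
Local Notation Cl := (clifford R p q).
Implicit Types (A B C : {set I}) (x y z : Cl).

Definition symdiff A B : {set I} := [set i | (i \in A) (+) (i \in B)].

Definition cl_exponent A B : nat :=
  \sum_(a in A) \sum_(b in B) ((b < a) || ((a == b) && (a < p)))%N.

Definition cl_sign A B : R := (-1) ^+ cl_exponent A B.

Definition cl_basis A : Cl := [ffun B => (B == A)%:R].

Definition cl_mul x y : Cl :=
  [ffun C => \sum_A cl_sign A (symdiff A C) * (x A * y (symdiff A C))].

Lemma symdiffA A B C : symdiff A (symdiff B C) = symdiff (symdiff A B) C.
Proof. by apply/setP => i; rewrite !inE addbA. Qed.

Lemma symdiffC A B : symdiff A B = symdiff B A.
Proof. by apply/setP => i; rewrite !inE addbC. Qed.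

Lemma symdiffK A : involutive (symdiff A).
Proof. by move=> B; apply/setP => i; rewrite !inE addKb. Qed.

Lemma symdiff0 A : symdiff A set0 = A.
Proof. by apply/setP => i; rewrite !inE addbF. Qed.

Lemma odd_sum_symdiff A B (f : I -> nat) :
  odd (\sum_(i in symdiff A B) f i) = odd (\sum_(i in A) f i) (+) odd (\sum_(i in B) f i).
Proof.
have e (X : {set I}) : \sum_(i in X) f i = \sum_i (if i \in X then f i else 0)%N.
  by rewrite big_mkcond.
rewrite -oddD !e -big_split /=.
apply: (big_ind2 (fun m n => odd m = odd n)) => // [m m' n n' h h'|i _].
  by rewrite !oddD h h'.
by rewrite inE; case: (i \in A); case: (i \in B) => //=; rewrite ?addn0 // oddD addbb.
Qed.

Lemma odd_sum_odd (P : pred I) (f g : I -> nat) :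
  (forall i, odd (f i) = odd (g i)) ->
  odd (\sum_(i | P i) f i) = odd (\sum_(i | P i) g i).
Proof.
move=> fg; apply: (big_ind2 (fun m n => odd m = odd n)) => // m m' n n' h h'.
by rewrite !oddD h h'.
Qed.

Lemma cl_expDl A B C :
  odd (cl_exponent (symdiff A B) C) = odd (cl_exponent A C) (+) odd (cl_exponent B C).
Proof. exact: odd_sum_symdiff. Qed.

Lemma cl_expDr A B C :
  odd (cl_exponent A (symdiff B C)) = odd (cl_exponent A B) (+) odd (cl_exponent A C).
Proof.
rewrite /cl_exponent -oddD -big_split /=; apply: odd_sum_odd => i.
by rewrite odd_sum_symdiff oddD.
Qed.

Lemma cl_signDl A B C : cl_sign (symdiff A B) C = cl_sign A C * cl_sign B C.
Proof.
by rewrite /cl_sign -signr_odd cl_expDl signr_addb !signr_odd.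
Qed.

Lemma cl_signDr A B C : cl_sign A (symdiff B C) = cl_sign A B * cl_sign A C.
Proof.
by rewrite /cl_sign -signr_odd cl_expDr signr_addb !signr_odd.
Qed.

Lemma cl_sign0l A : cl_sign set0 A = 1.
Proof. by rewrite /cl_sign /cl_exponent big_set0. Qed.

Lemma cl_sign0r A : cl_sign A set0 = 1.
Proof. by rewrite /cl_sign /cl_exponent big1 // => i _; rewrite big_set0. Qed.

Lemma cl_mulA : associative cl_mul.
Proof.
move=> x y z; apply/ffunP => C; rewrite !ffunE.
under eq_bigr => A _ do rewrite ffunE !mulr_sumr.
under [RHS]eq_bigr => D _ do rewrite ffunE mulr_suml mulr_sumr.
rewrite [RHS]exchange_big /=; apply: eq_bigr => A _.
rewrite [RHS](reindex_inj (can_inj (symdiffK A))) /=; apply: eq_bigr => B _.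
rewrite symdiffK -(symdiffA A B C) (symdiffC A (symdiff B C)) -(symdiffA B C A).
rewrite (symdiffC C A); set T := symdiff B (symdiff A C).
have -> : symdiff A C = symdiff B T by rewrite /T symdiffK.
rewrite !(cl_signDl, cl_signDr).
move: (x A : R) (y B : R) (z T : R) => xA yB zT; ring.
Qed.

Lemma cl_mul1x : left_id (cl_basis set0) cl_mul.
Proof.
move=> x; apply/ffunP => C; rewrite ffunE (bigD1 set0) //= big1 ?addr0.
  by rewrite ffunE eqxx symdiffC symdiff0 cl_sign0l !mul1r.
by move=> A /negPf A0; rewrite ffunE A0 mul0r mulr0.
Qed.

Lemma cl_mulx1 : right_id (cl_basis set0) cl_mul.
Proof.
have e A C : (symdiff A C == set0) = (A == C).
  apply/eqP/eqP => [h|->]; first by rewrite -(symdiff0 A) -h symdiffK.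
  by apply/setP => i; rewrite !inE addbb.
move=> x; apply/ffunP => C; rewrite ffunE (bigD1 C) //= big1 ?addr0.
  rewrite ffunE e eqxx mulr1 (_ : symdiff C C = set0) ?cl_sign0r ?mul1r //.
  by apply/eqP; rewrite e.
by move=> A /negPf A0; rewrite ffunE e A0 !mulr0.
Qed.

Lemma cl_mulDl : left_distributive cl_mul +%R.
Proof.
move=> x y z; apply/ffunP => C; rewrite !ffunE -big_split /=.
by apply: eq_bigr => A _; rewrite ffunE mulrDl mulrDr.
Qed.

Lemma cl_mulDr : right_distributive cl_mul +%R.
Proof.
move=> x y z; apply/ffunP => C; rewrite !ffunE -big_split /=.
by apply: eq_bigr => A _; rewrite ffunE !mulrDr.
Qed.

Lemma cl_one_neq0 : cl_basis set0 != 0.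
Proof.
apply/eqP => /ffunP/(_ set0); rewrite !ffunE eqxx => /eqP.
by rewrite oner_eq0.
Qed.

HB.instance Definition _ := GRing.Zmodule_isNzRing.Build Cl
  cl_mulA cl_mul1x cl_mulx1 cl_mulDl cl_mulDr cl_one_neq0.

Lemma cl_scaleAl (a : R) x y : a *: (x * y) = (a *: x) * y.
Proof.
apply/ffunP => C; rewrite !ffunE scaler_sumr; apply: eq_bigr => A _.
by rewrite ffunE /GRing.scale /= mulrCA !mulrA.
Qed.

Lemma cl_scaleAr (a : R) x y : a *: (x * y) = x * (a *: y).
Proof.
apply/ffunP => C; rewrite !ffunE scaler_sumr; apply: eq_bigr => A _.
by rewrite ffunE /GRing.scale /= mulrCA (mulrCA a).
Qed.

HB.instance Definition _ := GRing.Lmodule_isLalgebra.Build R Cl cl_scaleAl.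
HB.instance Definition _ := GRing.Lalgebra_isAlgebra.Build R Cl cl_scaleAr.
HB.instance Definition _ := Algebra_isFalgebra.Build R Cl.

Definition cl_vec (v : 'rV[R]_(p + q)) : Cl := \sum_i v 0 i *: cl_basis [set i].

Definition cl_part (odd_part : bool) : {vspace Cl} :=
  (\sum_(A : {set I} | odd #|A| == odd_part) <[cl_basis A]>)%VS.

(* The inclusion of so(V) in the even part: spin_of a is the element x of the
   span of the commutators of vectors such that [x, v] = a v for all v in V. *)
Definition spin_of (a : 'End('rV[R]_(p + q))) : Cl :=
  4^-1 *: \sum_i pq_sign R i *:
    (cl_vec (std_basis R i) * cl_vec (a (std_basis R i))).

Lemma cl_basisM A B : cl_basis A * cl_basis B = cl_sign A B *: cl_basis (symdiff A B).
Proof.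
apply/ffunP => C; rewrite !ffunE (bigD1 A) //= big1 ?addr0; last first.
  by move=> D /negPf DA; rewrite ffunE DA mul0r mulr0.
rewrite !ffunE eqxx mul1r.
have -> : (symdiff A C == B) = (C == symdiff A B).
  by apply/eqP/eqP => [<-|->]; rewrite symdiffK.
case: eqP => [->|_]; last by rewrite mulr0 /GRing.scale /= mulr0.
by rewrite symdiffK.
Qed.

Lemma cl_vec_is_linear : linear cl_vec.
Proof.
move=> a u v; rewrite /cl_vec scaler_sumr -big_split /=; apply: eq_bigr => i _.
by rewrite !mxE scalerDl scalerA.
Qed.
HB.instance Definition _ :=
  GRing.isSemilinear.Build R 'rV[R]_(p + q) Cl _ cl_vec
    (GRing.semilinear_linear cl_vec_is_linear).

Lemma cl_vec_basis i : cl_vec (std_basis R i) = cl_basis [set i].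
Proof.
rewrite /cl_vec (bigD1 i) //= big1 ?addr0; first by rewrite mxE !eqxx scale1r.
by move=> j /negPf ji; rewrite mxE ji andbF scale0r.
Qed.

Lemma cl_exponent1 (i j : I) :
  cl_exponent [set i] [set j] = ((j < i) || ((i == j) && (i < p)))%N.
Proof. by rewrite /cl_exponent !big_set1. Qed.

Lemma cl_basis_anticomm (i j : I) :
  cl_basis [set i] * cl_basis [set j] + cl_basis [set j] * cl_basis [set i]
  = (- 2 * pq_form (std_basis R i) (std_basis R j)) *: 1.
Proof.
rewrite !cl_basisM /cl_sign !cl_exponent1 pq_form_basisl mxE eqxx /=.
rewrite (symdiffC [set j]) -scalerDl.
have [<-|ij] := eqVneq i j.
  rewrite ltnn /= (_ : symdiff _ _ = set0); last first.
    by apply/setP => k; rewrite !inE addbb.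
  congr (_ *: _); rewrite /pq_sign (leqNgt p i) mulr1.
  by case: (i < p)%N => /=; rewrite ?expr0 ?expr1; ring.
rewrite mulr0n !mulr0 !orbF scale0r.
have [lt|gt|/val_inj/eqP] := ltngtP i j; last by rewrite (negPf ij).
  by rewrite /= expr0 expr1 subrr scale0r.
by rewrite /= expr0 expr1 addNr scale0r.
Qed.

Lemma cl_vec_anticomm (u v : 'rV[R]_(p + q)) :
  cl_vec u * cl_vec v + cl_vec v * cl_vec u = (- 2 * pq_form u v) *: 1.
Proof.

have e (x y : 'rV[R]_(p + q)) : cl_vec x * cl_vec y =
    \sum_i \sum_j (x 0 i * y 0 j) *: (cl_basis [set i] * cl_basis [set j]).
  rewrite /cl_vec mulr_suml; apply: eq_bigr => i _; rewrite mulr_sumr.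
  by apply: eq_bigr => j _; rewrite -scalerAl -scalerAr scalerA.
rewrite !e [X in _ + X]exchange_big /= -big_split /= pq_formE mulr_sumr scaler_suml.
apply: eq_bigr => i _; rewrite -big_split /=.
under eq_bigr => j _ do
  rewrite (mulrC (v 0 j)) -scalerDr cl_basis_anticomm scalerA pq_form_basisl.
rewrite (bigD1 i) //= big1 ?addr0 => [|j /negPf ji].
  by rewrite mxE !eqxx; congr (_ *: _); rewrite mulr1n; ring.
by rewrite mxE eq_sym ji andbF !mulr0 scale0r.
Qed.

Lemma cl_vec_sqr (v : 'rV[R]_(p + q)) : cl_vec v * cl_vec v = - (pq_form v v) *: 1.
Proof.
have h := cl_vec_anticomm v v; apply: (@scalerI _ _ 2).
  by rewrite pnatr_eq0.
by rewrite scalerA mulrN -mulNr -h -mulr2n scaler_nat.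
Qed.

Lemma cl_basis_part A : cl_basis A \in cl_part (odd #|A|).
Proof. by rewrite memvE (sumv_sup A) // eqb_id. Qed.

Lemma cl_vec_odd (v : 'rV[R]_(p + q)) : cl_vec v \in cl_part true.
Proof.
apply: memv_suml => i _; apply: memvZ.
by have := cl_basis_part [set i]; rewrite cards1.
Qed.

Lemma odd_symdiff A B : odd #|symdiff A B| = odd #|A| (+) odd #|B|.
Proof. by rewrite -!sum1_card odd_sum_symdiff. Qed.

Lemma cl_partM b c x y :
  x \in cl_part b -> y \in cl_part c -> x * y \in cl_part (b (+) c).
Proof.
move=> /memv_sumP[f fP ->] /memv_sumP[g gP ->].
rewrite mulr_suml; apply: memv_suml => A Ab; rewrite mulr_sumr.
apply: memv_suml => B Bc.
have /vlineP[a ->] := fP A Ab; have /vlineP[d ->] := gP B Bc.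
rewrite -scalerAl -scalerAr cl_basisM; do 3!apply: memvZ.
by rewrite -(eqP Ab) -(eqP Bc) -odd_symdiff cl_basis_part.
Qed.

Lemma spin_of_even a : spin_of a \in cl_part false.
Proof.
apply/memvZ/memv_suml => i _; apply: memvZ.
by apply: (@cl_partM true true); apply: cl_vec_odd.
Qed.

Lemma spin_ofP a : in_so a ->
  forall v, spin_of a * cl_vec v - cl_vec v * spin_of a = cl_vec (a v).
Proof.
move=> so_a v.
have comm (u w : 'rV[R]_(p + q)) :
    cl_vec u * cl_vec w * cl_vec v - cl_vec v * (cl_vec u * cl_vec w) =
    (- 2 * pq_form w v) *: cl_vec u + (2 * pq_form u v) *: cl_vec w.
  have -> : cl_vec u * cl_vec w * cl_vec v - cl_vec v * (cl_vec u * cl_vec w) =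
    cl_vec u * (cl_vec w * cl_vec v + cl_vec v * cl_vec w)
    - (cl_vec u * cl_vec v + cl_vec v * cl_vec u) * cl_vec w.
    by rewrite mulrDr mulrDl !mulrA opprD addrA addrK.
  by rewrite !cl_vec_anticomm -scalerAr mulr1 -scalerAl mul1r -scaleNr -mulNr opprK.
rewrite /spin_of -scalerAl -scalerAr -scalerBr mulr_suml mulr_sumr -sumrB.
have -> : cl_vec (a v) = 4^-1 *: (2 *: cl_vec (a v) + 2 *: cl_vec (a v)).
  rewrite -scalerDl scalerA -[LHS]scale1r; congr (_ *: _).
  by rewrite -natrD mulVf // pnatr_eq0.
have av1 : cl_vec (a v) = \sum_i (pq_sign R i * pq_form (std_basis R i) (a v)) *:
    cl_vec (std_basis R i).
  by rewrite {1}[a v]pq_expand linear_sum; apply: eq_bigr => i _; rewrite linearZ.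
have av2 : cl_vec (a v) = \sum_i (pq_sign R i * pq_form (std_basis R i) v) *:
    cl_vec (a (std_basis R i)).
  rewrite {1}[v]pq_expand !linear_sum; apply: eq_bigr => i _.
  by rewrite !linearZ.
congr (_ *: _); rewrite {1}av1 av2 !scaler_sumr -big_split /=.
apply: eq_bigr => i _.
rewrite -scalerAl -scalerAr -scalerBr comm scalerDr !scalerA.
have -> : pq_form (a (std_basis R i)) v = - pq_form (std_basis R i) (a v).
  by apply/eqP; rewrite -addr_eq0 so_a.
by congr (_ *: _ + _ *: _); ring.
Qed.


Lemma cl_expand x : x = \sum_A x A *: cl_basis A.
Proof.
apply/ffunP => C; rewrite sum_ffunE (bigD1 C) //= big1 ?addr0.
  by rewrite !ffunE eqxx /GRing.scale /= mulr1.
by move=> A /negPf CA; rewrite !ffunE eq_sym CA /GRing.scale /= mulr0.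
Qed.

Lemma cl_signK A B : cl_sign A B * cl_sign A B = 1.
Proof. by rewrite -expr2 sqrr_sign. Qed.

Lemma cl_set_ind (P : {set I} -> Prop) :
  P set0 -> (forall i A, i \notin A -> P A -> P (i |: A)) -> forall A, P A.
Proof.
move=> P0 PS A; move: {2}#|A| (erefl #|A|) => n; elim: n A => [|n IH] A.
  by move/eqP; rewrite cards_eq0 => /eqP ->.
move=> cA; have /set0Pn[i iA] : A != set0 by rewrite -cards_eq0 cA.
rewrite -(setD1K iA); apply: PS; first by rewrite !inE eqxx.
by apply: IH; apply/eqP; rewrite -eqSS -cA (cardsD1 i A) iA.
Qed.

Lemma symdiff1 i A : i \notin A -> symdiff [set i] A = i |: A.
Proof.
move=> iA; apply/setP => j; rewrite !inE.
by case: eqP => [->|//]; rewrite (negPf iA).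
Qed.

Lemma cl_basisU1 i A : i \notin A ->
  cl_basis (i |: A) = cl_sign [set i] A *: (cl_basis [set i] * cl_basis A).
Proof.
by move=> iA; rewrite cl_basisM scalerA cl_signK scale1r symdiff1.
Qed.

Theorem clifford_universal (B : algType R) (f : {linear 'rV[R]_(p + q) -> B}) :
  (forall v, f v * f v = - pq_form v v *: 1) ->
  exists2 g : {lrmorphism Cl -> B}, forall v, g (cl_vec v) = f v
    & forall h : {lrmorphism Cl -> B}, (forall v, h (cl_vec v) = f v) -> h =1 g.
Proof.
move=> fP; pose F i := f (std_basis R i).
have Fsq i : F i * F i = (-1) ^+ (i < p)%N *: 1.
  rewrite /F fP pq_form_basisl mxE !eqxx mulr1 /pq_sign leqNgt.
  by case: (i < p)%N; rewrite ?expr1 ?expr0 ?opprK.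
have Fanti i j : i != j -> F i * F j = - (F j * F i).
  move=> ij; apply/eqP; rewrite -addr_eq0; apply/eqP.
  have e : pq_form (std_basis R i + std_basis R j) (std_basis R i + std_basis R j)
     = pq_form (std_basis R i) (std_basis R i) + pq_form (std_basis R j) (std_basis R j).
    rewrite !pq_formE -big_split /=; apply: eq_bigr => k _; rewrite !mxE eqxx /=.
    have [->|ki] := eqVneq k i; first by rewrite (negPf ij) !(addr0, mul0r, mulr0).
    by rewrite !add0r mul0r mulr0 add0r.
  have := fP (std_basis R i + std_basis R j).
  rewrite linearD /= mulrDl !mulrDr !fP -/(F i) -/(F j) e.
  move: (pq_form _ _) (pq_form _ _) => b a; rewrite opprD scalerDl -addrA => /addrI.
  by rewrite addrA => h; apply: (addIr (- b *: 1)); rewrite h add0r.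
pose mr (r : seq I) A := \prod_(j <- r | j \in A) F j.
pose ex i (r : seq I) A := (\sum_(b <- r | b \in A) ((b < i) || ((i == b) && (i < p))))%N.
have mr_step i r A : sorted (relpre val ltn) r -> i \in r ->
    F i * mr r A = (-1) ^+ ex i r A *: mr r (symdiff [set i] A).
  elim: r => // k r IH /= kr; have r_sorted := path_sorted kr.
  have k_lt j : j \in r -> (k < j)%N.
    move: kr; rewrite path_sortedE; last by move=> ? ? ?; apply: ltn_trans.
    by case/andP=> /allP h _ /h.
  have skip X : i \notin r -> mr r (symdiff [set i] X) = mr r X.
    move=> ir; rewrite /mr big_seq_cond [RHS]big_seq_cond; apply: eq_bigl => j.
    case jr: (j \in r) => //=; rewrite !inE.
    by case: eqP jr ir => [->->|].
  rewrite inE /mr /ex !big_cons -/(mr r _) -/(mr r _) -/(ex i r A) !inE.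
  have [ik _|ik /= ir] := eqVneq i k.
    subst k; have ir : i \notin r by apply/negP => /k_lt; rewrite ltnn.
    have -> : ex i r A = 0%N.
      rewrite /ex big_seq_cond big1 // => b /andP[/k_lt ib _].
      by rewrite (ltn_eqF ib) ltnNge (ltnW ib).
    rewrite skip // /=; case: (i \in A) => /=.
      by rewrite mulrA Fsq ltnn eqxx addn0 /= -scalerAl mul1r.
    by rewrite expr0 scale1r.
  rewrite (_ : (i == k :> nat) = false) ?andFb ?orbF; last exact/negbTE.
   case: (k \in A); last exact: IH.
  rewrite mulrA Fanti // mulNr -mulrA IH // k_lt //= exprD expr1 mulN1r.
  by rewrite -scalerAr scaleNr.
have enum_sorted : sorted (relpre val ltn) (enum I).
  by rewrite -sorted_map val_enum_ord iota_ltn_sorted.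
pose m A := mr (enum I) A.
have m0 : m set0 = 1 by rewrite /m /mr big1 // => j; rewrite inE.
have m_step i A : F i * m A = cl_sign [set i] A *: m (symdiff [set i] A).
  rewrite /m mr_step ?mem_enum //; congr (_ ^+ _ *: _).
  by rewrite /cl_exponent big_set1 /ex big_enum_cond.
have mU1 i A : i \notin A -> m (i |: A) = cl_sign [set i] A *: (F i * m A).
  by move=> iA; rewrite m_step scalerA cl_signK scale1r symdiff1.
have mM A D : m A * m D = cl_sign A D *: m (symdiff A D).
  elim/cl_set_ind: A => [|i A iA IH].
    by rewrite m0 mul1r cl_sign0l scale1r symdiffC symdiff0.
  rewrite mU1 // -scalerAl -mulrA IH -scalerAr m_step !scalerA -symdiff1 //.
  rewrite symdiffA cl_signDl cl_signDr; congr (_ *: _).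
  by rewrite mulrCA !mulrA cl_signK mul1r mulrC.
pose g x := \sum_A x A *: m A.
have g_basis A : g (cl_basis A) = m A.
  rewrite /g (bigD1 A) //= big1 ?addr0; first by rewrite ffunE eqxx scale1r.
  by move=> D /negPf DA; rewrite ffunE DA scale0r.
have g_linear : linear g.
  move=> a x y; rewrite /g scaler_sumr -big_split /=; apply: eq_bigr => A _.
  by rewrite !ffunE scalerDl scalerA.
pose gl : {linear Cl -> B} := HB.pack g
  (GRing.isSemilinear.Build R Cl B _ g (GRing.semilinear_linear g_linear)).
have g_monoid : monoid_morphism g.
  split=> [|x y]; first by rewrite (g_basis set0).
  rewrite {1}[x]cl_expand {1}[y]cl_expand mulr_suml.
  rewrite [LHS](linear_sum gl) [in RHS]/g mulr_suml; apply: eq_bigr => A _.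
  rewrite !mulr_sumr [LHS](linear_sum gl); apply: eq_bigr => D _.
  rewrite -scalerAl -scalerAr cl_basisM !(linearZZ gl) /= g_basis -mM.
  by rewrite -scalerAl -scalerAr.
pose gr : {lrmorphism Cl -> B} := HB.pack g gl
  (GRing.isMonoidMorphism.Build Cl B g g_monoid).
have F_vec (h : {lrmorphism Cl -> B}) (hv : forall v, h (cl_vec v) = f v) A : h (cl_basis A) = m A.
  elim/cl_set_ind: A => [|i A iA IH]; first by rewrite m0 -(rmorph1 h).
  by rewrite cl_basisU1 // linearZ rmorphM /= IH mU1 // -cl_vec_basis hv.
exists gr => [v|h hv x].
  rewrite /= /cl_vec -[g]/(gl : Cl -> B) linear_sum [in RHS](row_sum_delta v) linear_sum.
  apply: eq_bigr => i _; rewrite !linearZ /= g_basis; congr (_ *: _).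
  rewrite -[[set i]]setU0 mU1 ?inE // m0 mulr1 cl_sign0r scale1r //.
by rewrite {1}[x]cl_expand linear_sum; apply: eq_bigr => A _; rewrite linearZ /= F_vec.
Qed.

End CliffordAlgebra.

Section SubspaceOf.
Context (R : realType) (W : vectType R).

(* The subspace with a given membership predicate, when there is one. *)
Definition subspace_of (P : W -> Prop) : {vspace W} :=
  classical_sets.xget 0%VS (fun U : {vspace W} => forall x, x \in U <-> P x).

Lemma mem_subspace_of (P : W -> Prop) :
  P 0 -> (forall a x y, P x -> P y -> P (a *: x + y)) ->
  forall x, x \in subspace_of P <-> P x.
Proof.
move=> P0 PL.
suff [U UP] : exists U : {vspace W}, forall x, x \in U <-> P x.
  rewrite /subspace_of; case: classical_sets.xgetP => [V _ VP //|nP].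
  by case: (nP U).
pose D d := `[< exists U : {vspace W}, \dim U = d /\ forall x, x \in U -> P x >].
have D0 : exists d, D d.
  exists 0%N; apply/asboolP; exists 0%VS; rewrite dimv0; split=> // x.
  by rewrite memv0 => /eqP ->.
have Dub d : D d -> (d <= \dim {:W})%N.
  by move=> /asboolP[U [<- _]]; apply/dimvS/subvf.
have [d /asboolP[U [Ud UP]] dmax] := ex_maxnP D0 Dub.
exists U => x; split=> [/UP //|Px].
suff : (U + <[x]> == U)%VS by move=> /eqP <-; rewrite memvE addvSr.
rewrite eq_sym eqEdim addvSl Ud dmax //; apply/asboolP.
exists (U + <[x]>)%VS; split=> // y /memv_addP[u uU [_ /vlineP[a ->] ->]].
by rewrite addrC; apply: PL => //; apply: UP.
Qed.

End SubspaceOf.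

Section CliffordModules.
Context (R : realType) (p q N : nat).
Context (rho : {lrmorphism clifford R p q -> 'M[R]_N}).
Implicit Types (P : {vspace clifford R p q}) (U W : {vspace 'cV[R]_N}).

Definition cl_stable P U : Prop :=
  forall x s, x \in P -> s \in U -> rho x *m s \in U.

Definition cl_irreducible P U : Prop :=
  [/\ U != 0%VS, cl_stable P U
    & forall W, (W <= U)%VS -> cl_stable P W -> W = 0%VS \/ W = U].

Definition cl_translate P U : {vspace 'cV[R]_N} :=
  <<[seq rho x *m s | x <- vbasis P, s <- vbasis U]>>%VS.

Lemma cl_translateP P U W :
  (cl_translate P U <= W)%VS <->
  forall x s, x \in P -> s \in U -> rho x *m s \in W.
Proof.
split=> [PUW x s xP sU|PUW].
  rewrite (coord_vbasis xP) (coord_vbasis sU) (linear_sum rho) mulmx_suml.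
  apply: memv_suml => i _; rewrite mulmx_sumr; apply: memv_suml => k _.
  rewrite (linearZZ rho) -scalemxAr -scalemxAl; do 2!apply: memvZ.
  apply/(subvP PUW)/memv_span/allpairs_f; apply: mem_nth; rewrite size_tuple //.
apply/span_subvP => _ /allpairsP[[x s] /= [xP sU ->]].
by apply: PUW; apply: vbasis_mem.
Qed.

End CliffordModules.

Record spinor_module (R : realType) (p q : nat) := SpinorModule {
  spinor_dim : nat;
  spinor_act : {lrmorphism clifford R p q -> 'M[R]_spinor_dim};
  spinor_irreducible : cl_irreducible spinor_act fullv fullv }.

Section SpinorBrackets.
Context (R : realType) (p q : nat) (S : spinor_module R p q).
Local Notation V := 'rV[R]_(p + q).
Local Notation N := (spinor_dim S).
Implicit Types (j : 'Hom(V, 'M[R]_N)) (Sp Sm : {vspace 'cV[R]_N}).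

Definition spinor_reducible : Prop :=
  ~ cl_irreducible (spinor_act S) (cl_part R p q false) fullv.

Definition semispinors Sp Sm : Prop :=
  [/\ cl_irreducible (spinor_act S) (cl_part R p q false) Sp,
      cl_irreducible (spinor_act S) (cl_part R p q false) Sm,
      (Sp + Sm)%VS = fullv, (Sp :&: Sm)%VS = 0%VS
    & Sm = cl_translate (spinor_act S) (cl_part R p q true) Sp].

(* The bilinear form on S with matrix b. *)
Definition form_of (b : 'M[R]_N) (s t : 'cV[R]_N) : R := (s^T *m b *m t) 0 0.

Definition so_equivariant j : Prop :=
  forall a : 'End(V), in_so a -> forall v s t,
    form_of (j (a v)) s t =
      - form_of (j v) (spinor_act S (spin_of a) *m s) t
      - form_of (j v) s (spinor_act S (spin_of a) *m t).

(* Signs: false stands for +, true for -. *)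
Definition has_symmetry (sigma : bool) j : Prop :=
  forall v s t, form_of (j v) t s = (-1) ^+ sigma * form_of (j v) s t.

Definition has_isotropy Sp Sm (iota : bool) j : Prop :=
  if iota then
    forall v s t, (s \in Sp /\ t \in Sp) \/ (s \in Sm /\ t \in Sm) ->
      form_of (j v) s t = 0
  else
    forall v s t, (s \in Sp /\ t \in Sm) \/ (s \in Sm /\ t \in Sp) ->
      form_of (j v) s t = 0.

Definition J : {vspace 'Hom(V, 'M[R]_N)} := subspace_of so_equivariant.

Definition J1 (sigma : bool) : {vspace 'Hom(V, 'M[R]_N)} :=
  subspace_of (fun j => j \in J /\ has_symmetry sigma j).

Definition J2 Sp Sm (sigma iota : bool) : {vspace 'Hom(V, 'M[R]_N)} :=
  subspace_of (fun j => j \in J1 sigma /\ has_isotropy Sp Sm iota j).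

Definition L1 (sigma : bool) : nat := \dim (J1 sigma).

Definition L2 Sp Sm (sigma iota : bool) : nat := \dim (J2 Sp Sm sigma iota).

Lemma form_of_linear s t : scalar (fun b => form_of b s t).
Proof.
move=> a b c; rewrite /form_of mulmxDr mulmxDl -scalemxAr -scalemxAl !mxE.
by [].
Qed.

Lemma form_comb a j j' v s t :
  form_of ((a *: j + j') v) s t = a * form_of (j v) s t + form_of (j' v) s t.
Proof. by rewrite add_lfunE scale_lfunE form_of_linear. Qed.

Lemma form_zero v s t : form_of ((0 : 'Hom(V, 'M[R]_N)) v) s t = 0.
Proof. by rewrite zero_lfunE /form_of mulmx0 mul0mx mxE. Qed.

Lemma mem_J j : j \in J <-> so_equivariant j.
Proof.
apply: mem_subspace_of => [a so_a v s t|a x y xP yP b so_b v s t].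
  by rewrite !form_zero subr0 oppr0.
by rewrite !form_comb xP // yP // mulrBr mulrN; ring.
Qed.

Lemma mem_J1 sigma j : j \in J1 sigma <-> j \in J /\ has_symmetry sigma j.
Proof.
apply: mem_subspace_of => [|a x y [xJ xP] [yJ yP]].
  by split=> [|v s t]; rewrite ?mem0v // !form_zero mulr0.
split=> [|v s t]; first by rewrite memvD ?memvZ.
by rewrite !form_comb xP yP mulrDr mulrCA.
Qed.

Lemma mem_J2 Sp Sm sigma iota j :
  j \in J2 Sp Sm sigma iota <-> j \in J1 sigma /\ has_isotropy Sp Sm iota j.
Proof.
apply: mem_subspace_of => [|a x y [xJ xP] [yJ yP]].
  by split; rewrite ?mem0v // /has_isotropy; case: iota => v s t _; rewrite form_zero.
split; first by rewrite memvD ?memvZ.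
move: xP yP; rewrite /has_isotropy.
by case: iota => xP yP v s t st;
  rewrite !form_comb xP // yP // mulr0 addr0.
Qed.

End SpinorBrackets.

Arguments semispinors {R p q} S Sp Sm.
Arguments J2 {R p q} S Sp Sm sigma iota.
Arguments L2 {R p q} S Sp Sm sigma iota.

Lemma minimal_subspace (F : fieldType) (vT : vectType F)
    (Q : {vspace vT} -> Prop) (U : {vspace vT}) : U != 0%VS -> Q U ->
  exists W : {vspace vT}, [/\ W != 0%VS, (W <= U)%VS, Q W
    & forall W', (W' <= W)%VS -> Q W' -> W' = 0%VS \/ W' = W].
Proof.
move=> U0 QU.
pose D d := `[< exists W : {vspace vT},
  [/\ W != 0%VS, (W <= U)%VS, Q W & \dim W = d] >].
have exD : exists d, D d by exists (\dim U); apply/asboolP; exists U.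
have [d /asboolP[W [W0 WU QW dW]] dmin] := ex_minnP exD.
exists W; split=> // W' W'W QW'; have [->|W'0] := eqVneq W' 0%VS; first by left.
right; apply/eqP; rewrite eqEdim W'W dW dmin //; apply/asboolP.
by exists W'; split=> //; apply: subv_trans WU.
Qed.

Lemma spinor_module_exists (R : realType) (p q : nat) :
  inhabited (spinor_module R p q).
Proof.
pose Cl := clifford R p q.
pose left_ideal (W : {vspace Cl}) := forall x w, w \in W -> x * w \in W.
have [|//|W [W0 _ idW Wmin]] := @minimal_subspace R Cl left_ideal fullv.
- by apply/eqP => f0; have := memvf (1 : Cl); rewrite f0 memv0 oner_eq0.
- by move=> x w _; apply: memvf.
pose N := \dim W; pose e (i : 'I_N) : Cl := (vbasis W)`_i.
have eW i : e i \in W by apply: vbasis_mem; rewrite mem_nth ?size_tuple.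
pose phi (c : 'cV[R]_N) : Cl := \sum_i c i 0 *: e i.
have phiE (c : 'cV[R]_N) i : coord (vbasis W) i (phi c) = c i 0.
  by rewrite coord_sum_free // (basis_free (vbasisP W)).
have phi_inj : injective phi.
  by move=> c d cd; apply/colP => i; rewrite -!phiE cd.
have phiW c : phi c \in W by apply: memv_suml => i _; apply: memvZ.
have phi_surj w : w \in W -> exists c, phi c = w.
  move=> wW; exists (\col_i coord (vbasis W) i w).
  by rewrite [RHS](coord_vbasis wW); apply: eq_bigr => i _; rewrite mxE.
pose r (x : Cl) : 'M[R]_N := \matrix_(i, k) coord (vbasis W) i (x * e k).
have phir x c : phi (r x *m c) = x * phi c.
  rewrite [RHS](coord_vbasis (idW x _ (phiW c))); apply: eq_bigr => i _.
  congr (_ *: _); rewrite mxE /phi mulr_sumr linear_sum.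
  by apply: eq_bigr => k _; rewrite mxE -scalerAr linearZ /= mulrC.
have phi_is_linear : linear phi.
  move=> a c d; rewrite /phi scaler_sumr -big_split /=; apply: eq_bigr => i _.
  by rewrite !mxE scalerDl scalerA.
have ext (A B : 'M[R]_N) : (forall c, phi (A *m c) = phi (B *m c)) -> A = B.
  move=> AB; apply/matrixP => i k; have /phi_inj/colP/(_ i) := AB (delta_mx k 0).
  by rewrite -!colE !mxE.
have r_linear : linear r.
  move=> a x y; apply: ext => c.
  by rewrite mulmxDl -scalemxAl phi_is_linear !phir mulrDl scalerAl.
have r_monoid : monoid_morphism r.
  split=> [|x y]; apply: ext => c; first by rewrite phir mul1r mul1mx.
  by rewrite -mulmxA !phir mulrA.
pose rl : {linear Cl -> 'M[R]_N} := HB.pack r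
  (GRing.isSemilinear.Build R Cl 'M[R]_N _ r (GRing.semilinear_linear r_linear)).
pose rho : {lrmorphism Cl -> 'M[R]_N} := HB.pack r rl
  (GRing.isMonoidMorphism.Build Cl 'M[R]_N r r_monoid).
constructor; apply: (@SpinorModule R p q N rho).
pose phil : {linear 'cV[R]_N -> Cl} := HB.pack phi
  (GRing.isSemilinear.Build R 'cV[R]_N Cl _ phi (GRing.semilinear_linear phi_is_linear)).
have phi0 : phi 0 = 0 by apply: (linear0 phil).
have phiI (U : {vspace 'cV[R]_N}) c : (phi c \in (linfun phil @: U)%VS) = (c \in U).
  apply/memv_imgP/idP => [[d dU]|cU]; last by exists c; rewrite ?lfunE.
  by rewrite lfunE => /phi_inj ->.
split=> [|x s _ _|U _ Ust]; [|exact: memvf|].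
  apply/eqP => f0; have [w wW w0] : exists2 w, w \in W & w != 0.
    by exists (vpick W); rewrite ?memv_pick ?vpick0.
  have [c cw] := phi_surj w wW; have := memvf c; rewrite f0 memv0 => /eqP c0.
  by move: w0; rewrite -cw c0 phi0 eqxx.
have [| |U0|UW] := Wmin (linfun phil @: U)%VS.
- by apply/subvP => _ /memv_imgP[c _ ->]; rewrite lfunE; apply: phiW.
- move=> x _ /memv_imgP[c cU ->]; rewrite lfunE -phir phiI.
  by apply: Ust => //; apply: memvf.
- left; apply/eqP; rewrite -subv0; apply/subvP => c; rewrite -phiI U0 !memv0.
  by move/eqP => c0; apply/eqP/phi_inj; rewrite c0 phi0.
- right; apply/eqP; rewrite eqEsubv subvf; apply/subvP => c _.
  by rewrite -phiI UW; apply: phiW.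
Qed.

Lemma cl_part_dec (R : realType) (p q : nat) (x : clifford R p q) :
  exists x0 x1, [/\ x0 \in cl_part R p q false, x1 \in cl_part R p q true
    & x = x0 + x1].
Proof.
pose f b := \sum_(A : {set 'I_(p + q)} | odd #|A| == b) x A *: cl_basis R A.
exists (f false), (f true); split.
- by apply: memv_suml => A /eqP <-; apply/memvZ/cl_basis_part.
- by apply: memv_suml => A /eqP <-; apply/memvZ/cl_basis_part.
rewrite [LHS]cl_expand (bigID (fun A : {set _} => odd #|A| == false)) /=.
by congr (_ + _); apply: eq_bigl => A; case: (odd _).
Qed.

Lemma semispinors_exist (R : realType) (p q : nat) (S : spinor_module R p q) :
  spinor_reducible S -> exists Sp Sm, semispinors S Sp Sm.
Proof.
case: S => N rho irr; rewrite /spinor_reducible /semispinors /= => red.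
have [f0 _ irrS] := irr.
pose ev := cl_part R p q false; pose od := cl_part R p q true.
have [x s _ _|] := @minimal_subspace R _ (cl_stable rho ev) fullv f0.
  exact: memvf.
move=> W [W0 _ Wst Wmin].
have rM x y (s : 'cV[R]_N) : rho x *m (rho y *m s) = rho (x * y) *m s.
  by rewrite mulmxA rmorphM.
have r1 (s : 'cV[R]_N) : rho 1 *m s = s by rewrite rmorph1 mul1mx.
have rD x y (s : 'cV[R]_N) : rho (x + y) *m s = rho x *m s + rho y *m s.
  by rewrite raddfD mulmxDl.
have Wf : W != fullv.
  apply/eqP => WE; apply: red; rewrite -WE; split=> // W' /Wmin; exact.
have [i _|noI] := pickP (fun _ : 'I_(p + q) => true); last first.
  have evf x : x \in ev.
    rewrite [x]cl_expand; apply: memv_suml => A _; apply: memvZ.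
    rewrite (_ : A = set0); last by apply/setP => k; have := noI k.
    by have := @cl_basis_part R p q set0; rewrite cards0.
  case: (irrS W (subvf W)) => [x s _|W1|W1]; first by apply: Wst.
  - by rewrite W1 eqxx in W0.
  - by rewrite W1 eqxx in Wf.
pose T := cl_vec (std_basis R i); pose c : R := - pq_form (std_basis R i) (std_basis R i).
have TT : T * T = c *: 1 by apply: cl_vec_sqr.
have c0 : c != 0.
  by rewrite /c pq_form_basisl mxE !eqxx mulr1 oppr_eq0 signr_eq0.
have Tod : T \in od by apply: cl_vec_odd.
have TK (s : 'cV[R]_N) : rho T *m (rho T *m s) = c *: s.
  by rewrite rM TT (linearZZ rho) -scalemxAl r1.
have oM x y : x \in od -> y \in od -> x * y \in ev by apply: (@cl_partM _ _ _ true true).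
have eoM x y : x \in ev -> y \in od -> x * y \in od by apply: (@cl_partM _ _ _ false true).
pose TI (U : {vspace 'cV[R]_N}) : {vspace 'cV[R]_N} := (linfun (mulmx (rho T)) @: U)%VS.
have memTI (U : {vspace 'cV[R]_N}) s : s \in TI U -> exists2 u, u \in U & s = rho T *m u.
  by case/memv_imgP => u uU ->; exists u; rewrite ?lfunE.
have TImem (U : {vspace 'cV[R]_N}) s : s \in U -> rho T *m s \in TI U.
  by move=> sU; apply/memv_imgP; exists s; rewrite ?lfunE.
have TIst (U : {vspace 'cV[R]_N}) : cl_stable rho ev U -> cl_stable rho ev (TI U).
  move=> Ust x _ xe /memTI[u uU ->].
  have -> : rho x *m (rho T *m u) = rho T *m (c^-1 *: (rho (T * x * T) *m u)).
    by rewrite -!rM -scalemxAr TK scalerK.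
  by apply/TImem/memvZ/Ust => //; rewrite -mulrA; apply: oM => //; apply: eoM.
have TIK (U : {vspace 'cV[R]_N}) : TI (TI U) = U.
  apply/eqP; rewrite eqEsubv; apply/andP; split; apply/subvP => s.
    by move=> /memTI[_ /memTI[u uU ->] ->]; rewrite TK memvZ.
  move=> sU; have -> : s = c^-1 *: (rho T *m (rho T *m s)) by rewrite TK scalerK.
  by apply/memvZ/TImem/TImem.
have TIS (U U' : {vspace 'cV[R]_N}) : (U <= U')%VS -> (TI U <= TI U')%VS by apply: limgS.
have odTI (U : {vspace 'cV[R]_N}) : cl_stable rho ev U -> forall x s, x \in od -> s \in U -> rho x *m s \in TI U.
  move=> Ust x s xo sU.
  have -> : rho x *m s = rho T *m (c^-1 *: (rho (T * x) *m s)).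
    by rewrite -rM -scalemxAr TK scalerK.
  by apply/TImem/memvZ/Ust => //; apply: oM.
have odE : cl_translate rho od W = TI W.
  apply/eqP; rewrite eqEsubv; apply/andP; split.
    by apply/cl_translateP => x s xo sW; apply: odTI.
  apply/subvP => _ /memTI[u uW ->].
  by have /cl_translateP := subvv (cl_translate rho od W); apply.
have full (U : {vspace 'cV[R]_N}) : cl_stable rho ev U -> (TI U <= U)%VS -> U != 0%VS -> U = fullv.
  move=> Ust TU U0; case: (irrS U (subvf U)) => [x s _ sU|U1|//]; last first.
    by rewrite U1 eqxx in U0.
  have [x0 [x1 [x0e x1o ->]]] := cl_part_dec x.
  rewrite rD; apply: memvD; first exact: Ust.
  by apply: (subvP TU); apply: odTI.
exists W, (TI W); split=> //; last first.
- apply/eqP/negPn/negP => I0.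
  case: (Wmin (W :&: TI W)%VS (capvSl _ _)) => [x s xe|/eqP|WI].
  - by rewrite !memv_cap => /andP[sW sT]; rewrite Wst // TIst.
  - by rewrite (negPf I0).
  have WT : (W <= TI W)%VS by have := capvSr W (TI W); rewrite WI.
  by move/eqP: Wf; apply; apply: full => //; rewrite -{2}(TIK W) TIS.
- apply: full.
  - move=> x _ xe /memv_addP[u uW [v vT ->]]; rewrite mulmxDr.
    by apply: memv_add; [apply: Wst|apply: TIst].
  - apply/subvP => _ /memTI[_ /memv_addP[u uW [v vT ->]] ->].
    rewrite mulmxDr addrC; apply: memv_add; last exact: TImem.
    by have := TImem _ _ vT; rewrite TIK.
  - by apply: contraNneq W0 => h; rewrite -subv0 -h addvSl.
- split; [|exact: TIst|].
    by apply: contraNneq W0 => h; rewrite -(TIK W) h /TI limg0.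
  move=> U UT Ust; case: (Wmin (TI U)); [|exact: TIst| |].
  - by rewrite -(TIK W) TIS.
  - by move=> U0; left; rewrite -(TIK U) U0 /TI limg0.
  - by move=> UW; right; rewrite -UW TIK.
Qed.

(* n and s stand for p + q and p - q modulo 8. *)
Definition mod8 (p q : nat) (n s : int) : Prop :=
  (p%:Z + q%:Z = n %[mod 8])%Z /\ (p%:Z - q%:Z = s %[mod 8])%Z.

Definition L_pair (R : realType) (p q : nat) (S : spinor_module R p q) : nat * nat :=
  (L1 S false, L1 S true).

Definition L_quad (R : realType) (p q : nat) (S : spinor_module R p q)
    (Sp Sm : {vspace 'cV[R]_(spinor_dim S)}) : nat * nat * nat * nat :=
  (L2 S Sp Sm false false, L2 S Sp Sm false true,
   L2 S Sp Sm true false, L2 S Sp Sm true true).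

Arguments L_quad {R p q} S Sp Sm.

(* Main.v *)
From HB Require Import structures.
Require Import Defs.
From mathcomp Require Import all_boot all_order all_algebra all_field.
From mathcomp Require Import boolp reals.
From mathcomp Require Import ring lra zify complex.

(** Every dimension in the theorem is the trace of a projector that averages
    over the finite group of Clifford monomials [e_A]. Such a trace is a signed
    sum of traces of monomials on [S] and of products of two such traces, and
    nearly all of these vanish: a monomial that anticommutes with another one is traceless. What
    remains depends on [N = dim S], on [n = p + q], and on the Gaussian integers
    [(1 - i)^p (1 + i)^q] and [(1 + i)^n], whose real and imaginary parts count
    even and odd monomials with signs. No classification of Clifford algebras or
    of their modules is needed.

    The module enters through two instances of the Frobenius-Schur count. Over
    an irreducible module the invariant symmetric forms are the multiples of one
    definite form ([sym_inv_irreducible]), because a symmetric pencil has a real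
    eigenvalue ([symmetric_pencil]) and its eigenspace is a submodule. For the
    full Clifford algebra this is a quadratic equation with [N] as its only
    positive root ([spinor_dim_equation]); for the even part it says that [S] is
    irreducible iff [N^2 + N Re ((1 - i)^p (1 + i)^q) = 2^n]
    ([spinor_irreducible_equation]).

    An equivariant map [j] has the form [j(v)(s, t) = b(v s, t)] for a unique
    form [b] that is invariant under [so(V)] ([so_equivariant_bracket],
    [bracket_of_equivariant]). Transposing all the forms [j(v)], and composing
    them with the grading [E] of [S = S+ + S-], become two commuting involutions
    of the space of the [b], with traces proportional to [N Im ((1 + i)^n)] and
    to [- <e_1, e_1> ... <e_n, e_n> tr (w E)^2], for [w = e_1 ... e_n] the
    volume element and [n] even. As [w E] commutes with the Clifford algebra, it
    is [1] or [-1] when [w^2 = 1], and it is a traceless complex structure when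
    [w^2 = -1]. This yields [L1_formula] and [L2_formula].

    Since [1 + i] and [1 - i] have eighth power [16], and
    [1 + i = i (1 - i)], these formulas only depend on [n] modulo 8 and [q]
    modulo 4, that is on [n] and [s] modulo 8, and the 32 cases are
    computed. *)

Set Implicit Arguments.
Unset Strict Implicit.
Unset Printing Implicit Defensive.

Import Order.TTheory GRing.Theory Num.Theory.

Local Open Scope ring_scope.

(** * Traces of operators on matrices *)

Section OperatorTrace.
Context (R : realType) (N : nat).
Implicit Types (A B X : 'M[R]_N).

(** The trace of a linear operator on matrices, as the sum of its diagonal
    entries in the basis of elementary matrices. *)
Definition optrace (f : 'M[R]_N -> 'M[R]_N) : R :=
  \sum_i \sum_j f (delta_mx i j) i j.

Lemma optrace_mulmx A B :
  optrace (fun X => A *m X *m B) = \tr A * \tr B.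
Proof.
rewrite /optrace /mxtrace mulr_suml; apply: eq_bigr => i _.
rewrite mulr_sumr; apply: eq_bigr => j _.
rewrite -(mul_delta_mx (0 : 'I_1)) mulmxA -colE -mulmxA -rowE.
by rewrite !mxE big_ord1 !mxE.
Qed.

Lemma optrace_mulmx_tr A B :
  optrace (fun X => A *m X^T *m B) = \tr (A *m B^T).
Proof.
rewrite /optrace /mxtrace; apply: eq_bigr => i _.
rewrite mxE; apply: eq_bigr => j _.
rewrite trmx_delta -(mul_delta_mx (0 : 'I_1)) mulmxA -colE -mulmxA -rowE.
by rewrite !mxE big_ord1 !mxE.
Qed.

Lemma optraceD (f g : 'M[R]_N -> 'M[R]_N) :
  optrace (fun X => f X + g X) = optrace f + optrace g.
Proof.
rewrite /optrace -big_split; apply: eq_bigr => i _.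
by rewrite -big_split; apply: eq_bigr => j _; rewrite mxE.
Qed.

Lemma optraceZ a (f : 'M[R]_N -> 'M[R]_N) :
  optrace (fun X => a *: f X) = a * optrace f.
Proof.
rewrite /optrace mulr_sumr; apply: eq_bigr => i _.
by rewrite mulr_sumr; apply: eq_bigr => j _; rewrite mxE.
Qed.

Lemma optrace_sum (I : finType) (P : pred I) (f : I -> 'M[R]_N -> 'M[R]_N) :
  optrace (fun X => \sum_(k | P k) f k X) = \sum_(k | P k) optrace (f k).
Proof.
rewrite /optrace [RHS]exchange_big /=; apply: eq_bigr => i _.
by rewrite [RHS]exchange_big /=; apply: eq_bigr => j _; rewrite summxE.
Qed.

Lemma eq_optrace (f g : 'M[R]_N -> 'M[R]_N) : f =1 g -> optrace f = optrace g.
Proof. by move=> fg; do 2!(apply: eq_bigr => ? _); rewrite fg. Qed.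

(** A subspace that is a retract of the matrix space has as its dimension the
    trace of the corresponding idempotent; for [a] the inclusion this is the
    familiar trace of a projector. *)
Lemma dim_retract (W : vectType R) (U : {vspace W})
    (a : W -> 'M[R]_N) (b : 'M[R]_N -> W) : linear a -> linear b ->
  (forall X, b X \in U) -> (forall u, u \in U -> b (a u) = u) ->
  (\dim U)%:R = optrace (fun X => a (b X)).
Proof.
move=> a_lin b_lin bU ba; set e := vbasis U.
pose al0 : {linear W -> 'M[R]_N} := HB.pack a
  (GRing.isSemilinear.Build R W 'M[R]_N _ a (GRing.semilinear_linear a_lin)).
pose bl0 : {linear 'M[R]_N -> W} := HB.pack b
  (GRing.isSemilinear.Build R 'M[R]_N W _ b (GRing.semilinear_linear b_lin)).
have [al aE] : exists al : {linear W -> 'M[R]_N}, a = al :> (_ -> _) by exists al0.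
have [bl bE] : exists bl : {linear 'M[R]_N -> W}, b = bl :> (_ -> _) by exists bl0.
rewrite {}aE {}bE {al0 bl0 a b a_lin b_lin} in bU ba *.
have eU k : e`_k \in U.
  have [lek|ltk] := leqP (size e) k; first by rewrite nth_default ?mem0v.
  exact/vbasis_mem/mem_nth.
have -> : optrace (fun X => al (bl X)) =
    \sum_(k < \dim U) coord e k (bl (al e`_k)).
  rewrite /optrace; under eq_bigr do under eq_bigr => j _ do
    rewrite (coord_vbasis (bU _)) linear_sum summxE.
  rewrite pair_big exchange_big /=; apply: eq_bigr => k _.
  rewrite [al _ in RHS]matrix_sum_delta pair_big /= !linear_sum.
  by apply: eq_bigr => ij _; rewrite linearZ !linearZ /= mxE mulrC.
rewrite (eq_bigr (fun=> 1)) ?sumr_const ?card_ord // => k _.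
by rewrite ba // coord_free ?eqxx // (basis_free (vbasisP U)).
Qed.

End OperatorTrace.

Section RealMatrices.
Context (R : realType) (N : nat).
Implicit Types (A B X : 'M[R]_N) (u : 'cV[R]_N).

Lemma matrix_of_lfun (f : 'End('cV[R]_N)) : exists X, forall u, X *m u = f u.
Proof.
exists (\matrix_(i, k) f (delta_mx k 0) i 0) => u.
rewrite [u in RHS]matrix_sum_delta linear_sum; apply/colP => i.
rewrite summxE mxE; apply: eq_bigr => k _.
by rewrite big_ord1 linearZ !mxE mulrC.
Qed.

Lemma mulmx_cV_inj A B : (forall u : 'cV[R]_N, A *m u = B *m u) -> A = B.
Proof.
move=> AB; apply/matrixP => i k; have /colP/(_ i) := AB (delta_mx k 0).
by rewrite -!colE !mxE.
Qed.

Lemma sqnorm_cV (m : nat) (u : 'cV[R]_m) :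
  ((u^T *m u) 0 0 = \sum_i u i 0 ^+ 2).
Proof. by rewrite mxE; apply: eq_bigr => i _; rewrite mxE expr2. Qed.

Lemma sqnorm_cV_ge0 (m : nat) (u : 'cV[R]_m) : 0 <= (u^T *m u) 0 0.
Proof. by rewrite sqnorm_cV; apply: sumr_ge0 => i _; apply: sqr_ge0. Qed.

Lemma sqnorm_cV_eq0 (m : nat) (u : 'cV[R]_m) : (u^T *m u) 0 0 = 0 -> u = 0.
Proof.
rewrite sqnorm_cV => /eqP; rewrite psumr_eq0 => [/allP h|i _]; last exact: sqr_ge0.
apply/colP => i; have := h i (mem_index_enum _); rewrite sqrf_eq0 => /eqP ->.
by rewrite mxE.
Qed.

(** Positivity only; symmetry is assumed separately where it is needed. *)
Definition posdef B := forall u, u != 0 -> 0 < (u^T *m B *m u) 0 0.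

Lemma unitmx_ker0 A : (forall u, A *m u = 0 -> u = 0) -> A \in unitmx.
Proof.
move=> A0; rewrite -unitmx_tr -row_free_unit -kermx_eq0; apply/eqP/row_matrixP => i.
rewrite row0; apply: trmx_inj; rewrite trmx0; apply: A0.
by apply: trmx_inj; rewrite trmx_mul trmxK -row_mul mulmx_ker row0 trmx0.
Qed.

Lemma posdef_unit B : posdef B -> B \in unitmx.
Proof.
move=> pB; apply: unitmx_ker0 => u Bu; apply/eqP/negPn/negP => /pB.
by rewrite -mulmxA Bu mulmx0 mxE ltxx.
Qed.

(** [1 + X^T X] is a scalar product for which a complex structure [X] is
    orthogonal, hence skew. *)
Lemma mxtrace_sqrN1 X : X *m X = - 1%:M -> \tr X = 0.
Proof.
move=> XX; pose B := 1%:M + X^T *m X.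
have Bu : B \in unitmx.
  apply/posdef_unit => u u0; rewrite mulmxDr mulmxDl mulmx1 mxE.
  rewrite ltr_wpDr //; first by rewrite mulmxA -mulmxA -trmx_mul sqnorm_cV_ge0.
  by rewrite lt_neqAle sqnorm_cV_ge0 andbT; apply: contra u0 => /eqP h;
    apply/eqP/sqnorm_cV_eq0.
have XB : X^T *m B = - (B *m X).
  have XTXT : X^T *m X^T = - 1%:M by rewrite -trmx_mul XX linearN /= trmx1.
  rewrite /B mulmxDr mulmxDl mulmx1 mul1mx mulmxA XTXT mulNmx mul1mx.
  by rewrite -mulmxA XX mulmxN mulmx1 opprD opprK addrC.
have : \tr X = - \tr X.
  rewrite -{1}[X]trmxK mxtrace_tr -[X^T]mulmx1 -(mulmxV Bu) mulmxA XB mulNmx.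
  by rewrite raddfN /= mxtrace_mulC mulmxA mulVmx // mul1mx.
lra.
Qed.

End RealMatrices.

(** * A real eigenvalue of a symmetric pencil *)

Section SymmetricPencil.
Context (R : realType) (N : nat).
Implicit Types (A B X : 'M[R]_N) (u : 'cV[R]_N).

Lemma Re_sum (I : Type) (r : seq I) (P : pred I) (F : I -> R[i]) :
  complex.Re (\sum_(k <- r | P k) F k) = \sum_(k <- r | P k) complex.Re (F k).
Proof.
by elim/big_rec2: _ => [//|k x y _ <-]; case: (F k) y => a b [c d].
Qed.

Lemma Im_sum (I : Type) (r : seq I) (P : pred I) (F : I -> R[i]) :
  complex.Im (\sum_(k <- r | P k) F k) = \sum_(k <- r | P k) complex.Im (F k).
Proof.
by elim/big_rec2: _ => [//|k x y _ <-]; case: (F k) y => a b [c d].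
Qed.

Lemma map_Re_mulmx (z : 'rV[R[i]]_N) X :
  map_mx (@complex.Re R) (z *m map_mx (real_complex R) X) = map_mx (@complex.Re R) z *m X.
Proof.
apply/rowP => k; rewrite !mxE Re_sum; apply: eq_bigr => l _; rewrite !mxE.
by case: (z 0 l) => a b /=; rewrite mulr0 subr0.
Qed.

Lemma map_Im_mulmx (z : 'rV[R[i]]_N) X :
  map_mx (@complex.Im R) (z *m map_mx (real_complex R) X) = map_mx (@complex.Im R) z *m X.
Proof.
apply/rowP => k; rewrite !mxE Im_sum; apply: eq_bigr => l _; rewrite !mxE.
by case: (z 0 l) => a b /=; rewrite mulr0 add0r.
Qed.

(** The spectral theorem, in the weak form of one real eigenvalue: a complex
    eigenvector [z] for [l] gives, by symmetry, [Im l * (z^* B z) = 0]. *)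
Lemma symmetric_pencil X B : (0 < N)%N -> X^T = X -> B^T = B -> posdef B ->
  exists l u, u != 0 /\ X *m u = l *: (B *m u).
Proof.
move=> N0 Xs Bs pB; have Bu := posdef_unit pB.
pose cx := map_mx (real_complex R) : 'M[R]_N -> 'M[R[i]]_N.
have [l] : exists l, root (char_poly (cx (invmx B *m X))) l.
  by apply/closed_rootP; rewrite size_char_poly; case: N N0.
rewrite -eigenvalue_root_char => /eigenvalueP[w wE w0].
pose z := w *m cx (invmx B).
have zB : z *m cx B = w by rewrite -mulmxA -map_mxM mulVmx // map_mx1 mulmx1.
have zX : z *m cx X = l *: (z *m cx B) by rewrite zB -wE /cx map_mxM mulmxA.
have z0 : z != 0 by apply: contraNneq w0 => z0; rewrite -zB z0 mul0mx.
pose a := map_mx (@complex.Re R) z; pose b := map_mx (@complex.Im R) z.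
have aX : a *m X = complex.Re l *: (a *m B) - complex.Im l *: (b *m B).
  rewrite -map_Re_mulmx zX -map_Re_mulmx -map_Im_mulmx.
  by apply/rowP => k; rewrite !mxE; case: l {wE zX} => l m; case: (\sum_j _).
have bX : b *m X = complex.Re l *: (b *m B) + complex.Im l *: (a *m B).
  rewrite -map_Im_mulmx zX -map_Re_mulmx -map_Im_mulmx.
  by apply/rowP => k; rewrite !mxE; case: l {wE zX aX} => l m; case: (\sum_j _).
have symE (Y : 'M[R]_N) (u v : 'rV_N) : Y^T = Y ->
    (u *m Y *m v^T) 0 0 = (v *m Y *m u^T) 0 0.
  move=> Ys; have -> : v *m Y *m u^T = (u *m Y *m v^T)^T.
    by rewrite !trmx_mul trmxK Ys mulmxA.
  by rewrite [RHS]mxE.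
have ab : a != 0 \/ b != 0.
  have [a0|] := eqVneq a 0; last by left.
  right; apply: contra_neq z0 => b0.
  apply/rowP => k; rewrite [RHS]mxE.
  have : a 0 k = 0 by rewrite a0 mxE.
  have : b 0 k = 0 by rewrite b0 mxE.
  by rewrite [a 0 k]mxE [b 0 k]mxE; case: (z 0 k) => c d /= -> ->.
have pBr (v : 'rV_N) : v != 0 -> 0 < (v *m B *m v^T) 0 0.
  by move=> v0; have := pB v^T; rewrite trmx_eq0 trmxK => /(_ v0).
have pBr0 (v : 'rV_N) : 0 <= (v *m B *m v^T) 0 0.
  by have [->|/pBr/ltW//] := eqVneq v 0; rewrite !mul0mx mxE.
(* [a X b^T = b X a^T], for the real part [a] and the imaginary part [b] of [z],
   says that [Im l * (a B a^T + b B b^T) = 0]. *)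
have m0 : complex.Im l = 0.
  have dX (u v w' : 'rV[R]_N) c d : (((c *: u + d *: v) *m w'^T) 0 0 : R) =
      c * (u *m w'^T) 0 0 + d * (v *m w'^T) 0 0.
    by rewrite mulmxDl -!scalemxAl !mxE.
  have := symE X a b Xs; rewrite aX bX -scaleNr !dX (symE B b a) //.
  have : 0 < (a *m B *m a^T) 0 0 + (b *m B *m b^T) 0 0.
    by case: ab => /pBr h; [apply: ltr_wpDr|apply: ltr_wpDl].
  move: ((a *m B *m a^T) 0 0) ((b *m B *m b^T) 0 0) => x y xy h.
  have : complex.Im l * (x + y) = 0 by lra.
  by move/eqP; rewrite mulf_eq0 (gt_eqF xy) orbF => /eqP.
have fin (v : 'rV_N) : v != 0 -> v *m X = complex.Re l *: (v *m B) ->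
    exists l u, u != 0 /\ X *m u = l *: (B *m u).
  move=> v0 vX; exists (complex.Re l), v^T; rewrite trmx_eq0; split=> //.
  apply: trmx_inj; rewrite linearZ /= !trmx_mul trmxK Xs Bs; exact: vX.
case: ab => [/fin|/fin]; apply; first by rewrite aX m0 scale0r subr0.
by rewrite bX m0 scale0r addr0.
Qed.

End SymmetricPencil.

(** * Signs and Gaussian sums *)

Section CliffordSigns.
Context (R : realType) (p q : nat).
Local Notation I := 'I_(p + q).
Local Notation sg := (cl_sign R).
Implicit Types (i j : I) (A B : {set I}).

(** [cl_square A] is the scalar square of the basis monomial indexed by [A]. *)
Definition cl_square A : R := sg A A.

Lemma cl_square1 i : cl_square [set i] = (-1) ^+ (i < p)%N.
Proof. by rewrite /cl_square /cl_sign cl_exponent1 ltnn eqxx. Qed.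

Lemma pq_sign_square1 i : pq_sign R i = - cl_square [set i].
Proof.
by rewrite cl_square1 /pq_sign leqNgt; case: (i < p)%N; rewrite /= ?expr0 ?expr1 ?opprK.
Qed.

Lemma cl_square_sqr A : cl_square A * cl_square A = 1.
Proof. exact: cl_signK. Qed.

(** [e_i] commutes with [e_A] up to the sign [(-1)^(|A| + [i in A])]. *)
Lemma cl_sign_swap1 A i : sg [set i] A = (-1) ^+ (#|A| + (i \in A)) * sg A [set i].
Proof.
suff h : sg A [set i] * sg [set i] A = (-1) ^+ (#|A| + (i \in A)).
  by rewrite -h mulrAC cl_signK mul1r.
elim/cl_set_ind: A => [|j A jA IH].
  by rewrite cl_sign0l cl_sign0r cards0 inE mulr1.
rewrite -symdiff1 // cl_signDl cl_signDr mulrACA IH symdiff1 // cardsU1 jA !inE.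
have [->|ij] := eqVneq i j.
  by rewrite (negPf jA) -expr2 sqrr_sign mul1r addn0 addn1 !exprS !mulN1r opprK.
rewrite add1n addSn exprS; congr (_ * _).
rewrite /cl_sign !cl_exponent1 (eq_sym j) (negPf ij) !orbF -exprD.
by case: ltngtP ij => // /val_inj ->; rewrite eqxx.
Qed.

Lemma cl_squareE A :
  cl_square A = (-1) ^+ 'C(#|A|, 2) * \prod_(i in A) cl_square [set i].
Proof.
elim/cl_set_ind: A => [|i A iA IH].
  by rewrite cards0 big_set0 mulr1 /cl_square cl_sign0l.
rewrite big_setU1 //= cardsU1 iA add1n binS bin1 exprD -symdiff1 //.
rewrite {1}/cl_square cl_signDl !cl_signDr -/(cl_square A) IH (cl_sign_swap1 A).
rewrite (negPf iA) addn0.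
have := cl_signK R A [set i]; rewrite -/(cl_square [set i]).
set a := sg A _; set b := cl_square _; set c := _ ^+ _; set d := _ ^+ _.
set e := \prod_(_ in _) _ => aa; transitivity (b * (c * (d * e)) * (a * a)).
  ring.
by rewrite aa; ring.
Qed.

(** The product of the [<e_i, e_i>] over [i] in [A]. *)
Definition pq_signs A : R := \prod_(i in A) pq_sign R i.

Lemma pq_signsE A :
  pq_signs A = (-1) ^+ #|A| * \prod_(i in A) cl_square [set i].
Proof.
rewrite /pq_signs; under eq_bigr do rewrite pq_sign_square1.
by rewrite prodrN.
Qed.

Lemma pq_signs_square A :
  pq_signs A * cl_square A = (-1) ^+ (#|A| + 'C(#|A|, 2)).
Proof.
rewrite cl_squareE pq_signsE mulrACA -exprD -big_split /= big1 ?mulr1 // => i _.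
exact: cl_square_sqr.
Qed.

Lemma pq_signs_symdiff A B : pq_signs (symdiff A B) = pq_signs A * pq_signs B.
Proof.
rewrite /pq_signs big_mkcond [X in _ = X * _]big_mkcond [X in _ = _ * X]big_mkcond.
rewrite -big_split; apply: eq_bigr => i _; rewrite inE.
by case: (i \in A); case: (i \in B); rewrite /= ?(mulr1, mul1r) // pq_signK.
Qed.

End CliffordSigns.

Section SubsetSums.
Context (R : realType) (I : finType).
Implicit Types (A : {set I}) (c : I -> R).

Lemma odd_bin2 k : odd 'C(k, 2) = odd k./2.
Proof.
elim/ltn_ind: k => -[|[|k]] // IH.
rewrite !binS bin0 bin1 !oddD (IH k) //=.
by case: (odd k); case: (odd k./2).
Qed.

Lemma signr_bin2 k : (-1) ^+ 'C(k, 2) = (-1) ^+ k./2 :> R.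
Proof. by rewrite -signr_odd odd_bin2 signr_odd. Qed.

(** Expanding [\prod_i (1 + c_i sqrt(-1))] and separating real and imaginary
    parts. *)
Lemma prod_gauss c :
  \prod_i (1 +i* c i)%C =
    Complex (\sum_(A : {set I} | ~~ odd #|A|) (-1) ^+ 'C(#|A|, 2) * \prod_(i in A) c i)
            (\sum_(A : {set I} | odd #|A|) (-1) ^+ 'C(#|A|, 2) * \prod_(i in A) c i).
Proof.
have iX k : ('i ^+ k = if odd k then 0 +i* ((-1) ^+ k./2 : R) else ((-1) ^+ k./2)%:C)%C.
  elim: k => // k; rewrite exprS => ->; rewrite /= uphalf_half.
  case: (odd k) => /=; rewrite ?add0n ?add1n ?exprS;
    by apply/eqP; rewrite eq_complex /=; apply/andP; split; apply/eqP; ring.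
have e i : (1 +i* c i = 1 + 'i * (c i)%:C)%C.
  by apply/eqP; rewrite eq_complex /=; apply/andP; split; apply/eqP; ring.
under eq_bigr do rewrite e addrC.
rewrite bigA_distr /=.
have t A : \prod_i (if i \in A then 'i%C * (c i)%:C%C else 1) =
    ('i%C ^+ #|A|) * (\prod_(i in A) c i)%:C%C.
  by rewrite -big_mkcond big_split prodr_const rmorph_prod.
under eq_bigr do rewrite t.
apply/eqP; rewrite eq_complex Re_sum Im_sum /=; apply/andP; split; apply/eqP.
  rewrite [RHS]big_mkcond; apply: eq_bigr => A _; rewrite iX signr_bin2.
  by case: (odd _) => /=; ring.
rewrite [RHS]big_mkcond; apply: eq_bigr => A _; rewrite iX signr_bin2.
by case: (odd _) => /=; ring.
Qed.

End SubsetSums.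

Section CliffordSums.
Context (R : realType) (p q : nat).
Local Notation I := 'I_(p + q).
Implicit Types (i j : I) (A B : {set I}).

Lemma prod_gauss_square :
  \prod_(i : I) (1 +i* cl_square R [set i] : R[i])%C = (1 -i* 1)%C ^+ p * (1 +i* 1)%C ^+ q.
Proof.
rewrite big_split_ord /=; congr (_ * _).
  rewrite (eq_bigr (fun=> 1 -i* 1)%C) ?prodr_const ?card_ord // => i _.
  by rewrite cl_square1 /= ltn_ord expr1.
rewrite (eq_bigr (fun=> 1 +i* 1)%C) ?prodr_const ?card_ord // => i _.
by rewrite cl_square1 /= ltnNge leq_addr expr0.
Qed.

Lemma sum_square_even :
  \sum_(A : {set I} | ~~ odd #|A|) cl_square R A =
  complex.Re ((1 -i* 1)%C ^+ p * (1 +i* 1)%C ^+ q).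
Proof. by under eq_bigr do rewrite cl_squareE; rewrite -prod_gauss_square prod_gauss. Qed.

Lemma sum_square_odd :
  \sum_(A : {set I} | odd #|A|) cl_square R A =
  complex.Im ((1 -i* 1)%C ^+ p * (1 +i* 1)%C ^+ q).
Proof. by under eq_bigr do rewrite cl_squareE; rewrite -prod_gauss_square prod_gauss. Qed.

Lemma sum_signs_square_odd :
  \sum_(A : {set I} | odd #|A|) pq_signs R A * cl_square R A =
  - complex.Im ((1 +i* 1)%C ^+ (p + q)).
Proof.
have -> : ((1 +i* 1)%C ^+ (p + q) : R[i]) = \prod_(i : I) (1 +i* 1)%C.
  by rewrite prodr_const card_ord.
rewrite prod_gauss /= -sumrN; apply: eq_bigr => A oA.
by rewrite pq_signs_square exprD -signr_odd oA expr1 mulN1r big1 // mulr1.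
Qed.

(** Multiplication by [e_0] exchanges the even and the odd monomials. *)
Lemma card_even : (0 < p + q)%N ->
  (#|[pred A : {set I} | ~~ odd #|A|]| * 2 = 2 ^ (p + q))%N.
Proof.
move=> n0; pose i0 := Ordinal n0.
have -> : (2 ^ (p + q) = #|{: {set I}}|)%N.
  by rewrite -[in LHS](card_ord (p + q)) -cardsT -card_powerset powersetT cardsT.
rewrite muln2 -addnn -(cardC [pred A : {set I} | ~~ odd #|A|]); congr (_ + _)%N.
rewrite -(card_image (can_inj (symdiffK [set i0]))); apply: eq_card => A.
rewrite !inE negbK; apply/imageP/idP => [[B]|oA].
  by rewrite !inE => eB ->; rewrite odd_symdiff cards1.
exists (symdiff [set i0] A); last by rewrite symdiffK.
by rewrite !inE odd_symdiff cards1 oA.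
Qed.

End CliffordSums.

(** * Averaging over the Clifford monomials *)

Section MonomialAction.
Context (R : realType) (p q N : nat).
Context (rho : {lrmorphism clifford R p q -> 'M[R]_N}).
Local Notation I := 'I_(p + q).
Implicit Types (i j : I) (A B : {set I}) (X Y Z : 'M[R]_N) (s : 'cV[R]_N).
Implicit Types (W U : {vspace 'cV[R]_N}).

(** The action of the basis monomial indexed by [A]. *)
Definition mono A : 'M[R]_N := rho (cl_basis R A).
Local Notation g := mono.

Lemma monoM A B : g A *m g B = cl_sign R A B *: g (symdiff A B).
Proof. by rewrite /mono -linearZ /= -cl_basisM rmorphM. Qed.

Lemma mono0 : g set0 = 1%:M.
Proof. exact: (rmorph1 rho). Qed.

Lemma mono_sqr A : g A *m g A = (cl_square R A)%:M.
Proof.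
rewrite monoM (_ : symdiff A A = set0); last by apply/setP => i; rewrite !inE addbb.
by rewrite mono0 scalemx1.
Qed.

Lemma mono_swap1 i A :
  g [set i] *m g A = (-1) ^+ (#|A| + (i \in A)) *: (g A *m g [set i]).
Proof. by rewrite !monoM scalerA cl_sign_swap1 symdiffC. Qed.

Lemma rho_mono x : rho x = \sum_A x A *: g A.
Proof. by rewrite {1}[x]cl_expand linear_sum; apply: eq_bigr => A _; rewrite linearZ. Qed.

Lemma mxtrace_anticomm Y Z c : c != 0 -> Z *m Z = c%:M -> Y *m Z = - (Z *m Y) ->
  \tr Y = 0.
Proof.
move=> c0 ZZ YZ; have : c * \tr Y = - (c * \tr Y).
  transitivity (\tr (Y *m Z *m Z)); first by rewrite -mulmxA ZZ mul_mx_scalar mxtraceZ.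
  by rewrite YZ mulNmx raddfN /= mxtrace_mulC mulmxA ZZ mul_scalar_mx mxtraceZ.
move=> h; have : c * \tr Y = 0 by lra.
by move/eqP; rewrite mulf_eq0 (negPf c0) => /eqP.
Qed.

Lemma cl_square_neq0 A : cl_square R A != 0.
Proof. by rewrite signr_eq0. Qed.

(** A nontrivial even monomial anticommutes with each of its factors. *)
Lemma mxtrace_mono_even A : ~~ odd #|A| -> A != set0 -> \tr (g A) = 0.
Proof.
move=> eA /set0Pn[i iA]; apply: (mxtrace_anticomm (cl_square_neq0 [set i])).
  exact: mono_sqr.
by rewrite mono_swap1 iA -signr_odd oddD (negPf eA) expr1 scaleN1r opprK.
Qed.

(** An odd monomial anticommutes with each [e_i] that is not one of its
    factors. *)
Lemma mxtrace_mono_odd A : odd #|A| -> A != setT -> \tr (g A) = 0.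
Proof.
move=> oA; rewrite -properT => /properP[_ [i _ iA]].
apply: (mxtrace_anticomm (cl_square_neq0 [set i])); first exact: mono_sqr.
by rewrite mono_swap1 (negPf iA) -signr_odd oddD oA expr1 scaleN1r opprK.
Qed.

Lemma mxtrace_mono0 : \tr (g set0) = N%:R.
Proof. by rewrite mono0 mxtrace1. Qed.

Lemma mxtrace_mono_sqr A : \tr (g A *m g A) = N%:R * cl_square R A.
Proof. by rewrite mono_sqr mxtrace_scalar mulr_natl. Qed.

Lemma mono_tr_mulmx A : (g A)^T *m (g A)^T = (cl_square R A)%:M.
Proof. by rewrite -trmx_mul mono_sqr tr_scalar_mx. Qed.

Lemma mono_commute1 X : (forall i, g [set i] *m X = X *m g [set i]) ->
  forall A, g A *m X = X *m g A.
Proof.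
move=> cX; elim/cl_set_ind=> [|i A iA IH]; first by rewrite mono0 mul1mx mulmx1.
have -> : g (i |: A) = cl_sign R [set i] A *: (g [set i] *m g A).
  by rewrite monoM scalerA cl_signK scale1r symdiff1.
by rewrite -scalemxAl -scalemxAr -mulmxA IH !mulmxA cX.
Qed.

(** The kernel of a matrix, acting on columns. *)
Definition ker_cV Y : {vspace 'cV[R]_N} := lker (linfun (mulmx Y)).

Lemma mem_ker_cV Y s : (s \in ker_cV Y) = (Y *m s == 0).
Proof. by rewrite memv_ker lfunE. Qed.

Lemma ker_cV_full Y : ker_cV Y = fullv -> Y = 0.
Proof.
move=> Yf; apply/matrixP => i k; have := memvf (delta_mx k 0 : 'cV[R]_N).
by rewrite -Yf mem_ker_cV -colE => /eqP/colP/(_ i); rewrite !mxE.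
Qed.

Lemma ker_cV0 Y : ker_cV Y = 0%VS -> forall s, Y *m s = 0 -> s = 0.
Proof. by move=> Y0 s /eqP; rewrite -mem_ker_cV Y0 memv0 => /eqP. Qed.

Lemma ker_cV_exists W : exists Y, ker_cV Y = W.
Proof.
have [Y Yf] := matrix_of_lfun (\1%VF - projv W).
exists Y; apply/vspaceP => s; rewrite mem_ker_cV Yf add_lfunE opp_lfunE id_lfunE.
rewrite subr_eq0; apply/eqP/idP => [->|/projv_id->//]; exact: memv_proj.
Qed.

Section Irreducibility.
(** [D] is a set of monomials that is closed under products up to sign: all of
    them, or the even ones. *)
Variable D : pred {set I}.
Hypothesis D0 : D set0.
Hypothesis DM : forall A B, D A -> D (symdiff A B) = D B.

Definition mono_stable W := forall A s, D A -> s \in W -> g A *m s \in W.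

(** There are no stable subspaces except [0] and the whole module; the module
    itself may be [0]. *)
Definition mono_irreducible := forall W, mono_stable W -> W = 0%VS \/ W = fullv.

Lemma mono_commute_involution X : mono_irreducible ->
  (forall A, D A -> g A *m X = X *m g A) -> X *m X = 1%:M ->
  X = 1%:M \/ X = - 1%:M.
Proof.
move=> irr cX XX; have [A s DA|h|/ker_cV_full h] := irr (ker_cV (X - 1%:M)).
- rewrite !mem_ker_cV !mulmxBl !mul1mx !subr_eq0 => /eqP Xs.
  by rewrite mulmxA -cX // -mulmxA Xs.
- right; apply/eqP; rewrite -addr_eq0; apply/eqP/matrixP => i k.
  have /(ker_cV0 h) e : (X - 1%:M) *m ((X + 1%:M) *m (delta_mx k 0 : 'cV_N)) = 0.
    by rewrite mulmxA mulmxDr !mulmxBl !mulmx1 !mul1mx XX addrC subrKA subrr mul0mx.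
  by have /colP/(_ i) := e; rewrite -colE !mxE.
- by left; apply/eqP; rewrite -subr_eq0 h.
Qed.

Section Averaging.
(** A multiplicative weight on the monomials. *)
Variable chi : {set I} -> R.
Hypothesis chiM : forall A B, chi (symdiff A B) = chi A * chi B.

(** [e_A] acting on the bilinear form with matrix [X], weighted by [chi]. *)
Definition twist A X : 'M[R]_N := chi A *: ((g A)^T *m X *m g A).
Definition twist_inv X := forall A, D A -> twist A X = X.

(** The projector onto the forms that are invariant under [D]. *)
Definition average X : 'M[R]_N := (#|D|%:R)^-1 *: \sum_(A | D A) twist A X.

Lemma card_D_neq0 : #|D|%:R != 0 :> R.
Proof. by rewrite pnatr_eq0 -lt0n; apply/card_gt0P; exists set0. Qed.

Lemma twistM A B X : twist A (twist B X) = twist (symdiff B A) X.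
Proof.
rewrite /twist chiM -scalemxAr -scalemxAl scalerA mulrC; congr (_ *: _).
have -> : g (symdiff B A) = cl_sign R B A *: (g B *m g A).
  by rewrite monoM scalerA cl_signK scale1r.
rewrite [(_ *: _)^T]linearZ /= -!scalemxAl -scalemxAr scalerA cl_signK scale1r.
by rewrite trmx_mul !mulmxA.
Qed.

Lemma twist_linear A : linear (twist A).
Proof.
move=> a X Y; rewrite /twist mulmxDr mulmxDl -scalemxAr -scalemxAl.
by rewrite scalerDr !scalerA (mulrC a).
Qed.

Lemma average_linear : linear average.
Proof.
move=> a X Y; rewrite /average [a *: (_ *: _)]scalerA (mulrC a) -scalerA -scalerDr; congr (_ *: _).
by rewrite scaler_sumr -big_split /=; apply: eq_bigr => A _; rewrite twist_linear.
Qed.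

Lemma twist_sum A (J : finType) (P : pred J) (F : J -> 'M[R]_N) :
  twist A (\sum_(k | P k) F k) = \sum_(k | P k) twist A (F k).
Proof. by rewrite /twist mulmx_sumr mulmx_suml scaler_sumr. Qed.

Lemma twistZ A a X : twist A (a *: X) = a *: twist A X.
Proof. by rewrite /twist -scalemxAr -scalemxAl !scalerA mulrC. Qed.

Lemma twistD A X Y : twist A (X + Y) = twist A X + twist A Y.
Proof. by rewrite -{1}[X]scale1r twist_linear scale1r. Qed.

Lemma twist_tr A X : twist A X^T = (twist A X)^T.
Proof. by rewrite /twist linearZ /= !trmx_mul trmxK mulmxA. Qed.

Lemma average_inv X : twist_inv (average X).
Proof.
move=> A DA; rewrite /average twistZ twist_sum; congr (_ *: _).
rewrite [RHS](reindex_inj (can_inj (symdiffK A))) /=; apply: eq_big => [B|B _].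
  by rewrite DM.
by rewrite twistM symdiffC.
Qed.

Lemma average_id X : twist_inv X -> average X = X.
Proof.
move=> iX; rewrite /average (eq_bigr (fun=> X)) // sumr_const -scaler_nat scalerA.
by rewrite mulVf ?scale1r // card_D_neq0.
Qed.

Lemma twist_inv_lin a X Y : twist_inv X -> twist_inv Y -> twist_inv (a *: X + Y).
Proof. by move=> iX iY A DA; rewrite twist_linear iX ?iY. Qed.

Lemma optrace_average :
  optrace average = (#|D|%:R)^-1 * \sum_(A | D A) chi A * (\tr (g A)) ^+ 2.
Proof.
rewrite optraceZ optrace_sum; congr (_ * _); apply: eq_bigr => A _.
by rewrite optraceZ optrace_mulmx mxtrace_tr expr2.
Qed.

(** The operator [X -> Y^T X^T Z] after averaging. *)
Lemma optrace_average_mulmx_tr Y Z :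
  optrace (fun X => Y^T *m (average X)^T *m Z) =
  (#|D|%:R)^-1 * \sum_(A | D A) chi A * \tr (g A *m Y *m g A *m Z).
Proof.
rewrite -[RHS]/(_ * _) mulr_sumr.
transitivity (optrace (fun X => \sum_(A | D A) (#|D|%:R)^-1 *: (chi A *:
    ((g A *m Y)^T *m X^T *m (g A *m Z))))).
  apply: eq_optrace => X; rewrite /average linearZ /= -scaler_sumr -scalemxAr -scalemxAl.
  congr (_ *: _); rewrite linear_sum mulmx_sumr mulmx_suml; apply: eq_bigr => A _.
  by rewrite linearZ /= -scalemxAr -scalemxAl !trmx_mul trmxK !mulmxA.
rewrite optrace_sum; apply: eq_bigr => A _; rewrite !optraceZ optrace_mulmx_tr.
by rewrite -trmx_mul mxtrace_tr mxtrace_mulC !mulmxA.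
Qed.

Lemma optrace_average_mulmx Y Z :
  optrace (fun X => Y *m average X *m Z) =
  (#|D|%:R)^-1 * \sum_(A | D A) chi A * (\tr (g A *m Y^T) * \tr (g A *m Z)).
Proof.
rewrite mulr_sumr.
transitivity (optrace (fun X => \sum_(A | D A) (#|D|%:R)^-1 *: (chi A *:
    ((Y *m (g A)^T) *m X *m (g A *m Z))))).
  apply: eq_optrace => X; rewrite /average -scaler_sumr -scalemxAr -scalemxAl.
  congr (_ *: _); rewrite mulmx_sumr mulmx_suml; apply: eq_bigr => A _.
  by rewrite -scalemxAr -scalemxAl !mulmxA.
rewrite optrace_sum; apply: eq_bigr => A _; rewrite !optraceZ optrace_mulmx.
by rewrite -[\tr (Y *m _)]mxtrace_tr trmx_mul trmxK.
Qed.

End Averaging.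

End Irreducibility.
End MonomialAction.

(** * Invariant symmetric forms and irreducibility *)

Section InvariantForms.
Context (R : realType) (p q N : nat).
Context (rho : {lrmorphism clifford R p q -> 'M[R]_N}).
Local Notation I := 'I_(p + q).
Local Notation g := (mono rho).
Implicit Types (i j : I) (A B : {set I}) (X Y Z : 'M[R]_N) (s : 'cV[R]_N).
Variable D : pred {set I}.
Hypothesis D0 : D set0.
Hypothesis DM : forall A B, D A -> D (symdiff A B) = D B.

Let one A : R := 1.
Let oneM A B : one (symdiff A B) = one A * one B.
Proof. by rewrite mulr1. Qed.

(** The symmetric bilinear forms [X] with [X(e_A s, e_A t) = X(s, t)] for all
    [A] in [D]. *)
Definition sym_inv X := twist_inv rho D (fun=> 1) X /\ X^T = X.

Lemma mem_sym_inv X : X \in subspace_of sym_inv <-> sym_inv X.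
Proof.
apply: mem_subspace_of => [|a Y Z [iY sY] [iZ sZ]].
  by split=> [A _|]; rewrite /twist ?trmx0 // mulmx0 mul0mx scaler0.
by split; [apply: twist_inv_lin|rewrite linearD linearZ /= sY sZ].
Qed.

(** The count of Frobenius and Schur, restricted to symmetric forms. *)
Lemma dim_sym_inv : (\dim (subspace_of sym_inv))%:R * (2 * #|D|%:R) =
  \sum_(A | D A) (\tr (g A)) ^+ 2 + N%:R * \sum_(A | D A) cl_square R A.
Proof.
pose av := average rho D one.
pose b X := 2^-1 *: (av X + (av X)^T).
have b_lin : linear b.
  move=> a X Y; rewrite /b /av average_linear [(_ + _)^T]linearP /=.
  by rewrite addrACA -scalerDr [LHS]scalerDr !scalerA (mulrC a).
rewrite (@dim_retract R N _ _ id b) //.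
- rewrite /b optraceZ optraceD optrace_average.
  rewrite (eq_optrace (g := fun X => (1%:M)^T *m (av X)^T *m 1%:M)); last first.
    by move=> X; rewrite trmx1 mul1mx mulmx1.
  rewrite optrace_average_mulmx_tr; have := card_D_neq0 R D0.
  set m := _%:R => m0; set S1 := \sum_(_ | _) _; set S2 := \sum_(_ | _) _.
  have -> : 2^-1 * (m^-1 * S1 + m^-1 * S2) * (2 * m) = S1 + S2 by field.
  congr (_ + _).
    by apply: eq_bigr => A _; rewrite mul1r.
  rewrite mulr_sumr; apply: eq_bigr => A _.
  by rewrite mul1r !mulmx1 mxtrace_mono_sqr.
- move=> X; apply/mem_sym_inv; split=> [A DA|]; last first.
    by rewrite linearZ linearD /= trmxK addrC.
  have aX : twist_inv rho D one (av X) by apply: average_inv.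
  by rewrite -[RHS]/(b X) /b twistZ -[av X]scale1r twist_linear twist_tr twistZ !aX.
- move=> X /mem_sym_inv[iX sX]; rewrite /b /av average_id // sX -mulr2n.
  by rewrite -scaler_nat scalerA mulVf ?scale1r // pnatr_eq0.
Qed.

(** The sum of the transforms of the standard scalar product. *)
Definition gram : 'M[R]_N := \sum_(A | D A) (g A)^T *m g A.

Lemma gram_form s X : (s^T *m (X^T *m X) *m s) 0 0 = ((X *m s)^T *m (X *m s)) 0 0.
Proof. by rewrite trmx_mul !mulmxA. Qed.

Lemma gram_posdef : posdef gram.
Proof.
move=> s s0; rewrite /gram (bigD1 set0) //= mono0 trmx1 mul1mx mulmxDr mulmxDl mulmx1.
rewrite mxE ltr_wpDr //; last first.
  by rewrite lt_neqAle sqnorm_cV_ge0 andbT; apply: contra s0 => /eqP h;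
    apply/eqP/sqnorm_cV_eq0.
rewrite mulmx_sumr mulmx_suml summxE sumr_ge0 // => A _.
by rewrite gram_form sqnorm_cV_ge0.
Qed.

Lemma gram_inv (M : 'M[R]_N) :
  sym_inv (\sum_(A | D A) twist rho one A (M^T *m M)).
Proof.
split=> [A DA|]; last first.
  by rewrite linear_sum; apply: eq_bigr => A _; rewrite /= -twist_tr trmx_mul trmxK.
rewrite twist_sum [RHS](reindex_inj (can_inj (symdiffK A))) /=.
apply: eq_big => [B|B _]; first by rewrite DM.
by rewrite twistM // symdiffC.
Qed.

Lemma gramE : gram = \sum_(A | D A) twist rho one A ((1%:M)^T *m 1%:M).
Proof.
by apply: eq_bigr => A _; rewrite /twist scale1r trmx1 !mulmx1.
Qed.

Lemma sym_inv_gram : sym_inv gram.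
Proof. by rewrite gramE; apply: gram_inv. Qed.

Lemma gram_neq0 : (0 < N)%N -> gram != 0.
Proof.
move=> N0; apply/eqP => g0.
have := gram_posdef (u := const_mx 1); rewrite g0 mulmx0 mul0mx mxE ltxx.
have nz : (const_mx 1 : 'cV[R]_N) != 0.
  by apply/eqP => /colP/(_ (Ordinal N0)); rewrite !mxE => /eqP; rewrite oner_eq0.
by move=> /(_ nz).
Qed.

(** A variant of Schur's lemma: over an irreducible module the invariant
    symmetric forms are the multiples of a single definite one. *)
Lemma sym_inv_irreducible X : (0 < N)%N -> mono_irreducible rho D ->
  sym_inv X -> exists l, X = l *: gram.
Proof.
move=> N0 irr [iX sX]; have [iG sG] := sym_inv_gram.
have [l [u [u0 Xu]]] := symmetric_pencil N0 sX sG gram_posdef.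
exists l; have iY : twist_inv rho D one (- l *: gram + X) by apply: twist_inv_lin.
(* The kernel of [X - l gram] is stable, and contains [u]. *)
have [A s DA|k0|/ker_cV_full] := irr (ker_cV (- l *: gram + X)).
- rewrite !mem_ker_cV => /eqP Ys.
  have gA : (g A)^T *m ((- l *: gram + X) *m (g A *m s)) = 0.
    by have := iY A DA; rewrite /twist scale1r => h; rewrite !mulmxA h.
  have := congr1 (mulmx (g A)^T) gA; rewrite mulmxA mono_tr_mulmx mul_scalar_mx mulmx0.
  by move/eqP; rewrite scaler_eq0 (negPf (cl_square_neq0 _ _)).
- have := ker_cV0 k0 (s := u); rewrite mulmxDl Xu scaleNr mulNmx -scalemxAl addNr.
  by move=> /(_ erefl) u00; rewrite u00 eqxx in u0.
- by rewrite scaleNr addrC => /eqP; rewrite subr_eq0 => /eqP.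
Qed.

(** Conversely, a nonzero proper submodule [W] gives an invariant semidefinite form with
    radical [W], which is not a multiple of the definite one. *)
Lemma dim_sym_inv_irreducible : (0 < N)%N ->
  mono_irreducible rho D <-> \dim (subspace_of sym_inv) = 1%N.
Proof.
move=> N0; have gU : (<[gram]> <= subspace_of sym_inv)%VS.
  by rewrite -memvE; apply/mem_sym_inv/sym_inv_gram.
have dg : \dim <[gram]> = 1%N by rewrite dim_vline gram_neq0.
split=> [irr|d1 W stW].
  rewrite -dg; congr (\dim _); apply/eqP; rewrite eqEsubv gU andbT.
  apply/subvP => X /mem_sym_inv /(sym_inv_irreducible N0 irr) [l ->].
  by rewrite memvZ // memv_line.
have UE : (<[gram]> == subspace_of sym_inv)%VS by rewrite eqEdim gU dg d1.
have [M MW] := ker_cV_exists W; have := gram_inv M.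
move=> /mem_sym_inv; rewrite -(eqP UE) => /vlineP[l lE].
have form s : (s^T *m (\sum_(A | D A) twist rho one A (M^T *m M)) *m s) 0 0 =
    \sum_(A | D A) ((M *m g A *m s)^T *m (M *m g A *m s)) 0 0.
  rewrite mulmx_sumr mulmx_suml summxE; apply: eq_bigr => A _.
  by rewrite /twist scale1r !trmx_mul !mulmxA.
(* The form is [l] times a definite one: it vanishes on [W], so [W = 0] unless
   [l = 0]; and if [l = 0] it vanishes everywhere, so [W] is full. *)
have [l0|l0] := eqVneq l 0; last first.
  left; apply/eqP; rewrite -subv0; apply/subvP => s sW; rewrite memv0.
  apply/negPn/negP => /gram_posdef; have := form s; rewrite lE big1 => [|A DA].
    by rewrite -scalemxAr -scalemxAl mxE => /eqP; rewrite mulf_eq0 (negPf l0) => /eqP->;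
      rewrite ltxx.
  have : g A *m s \in W by apply: stW.
  by rewrite -MW mem_ker_cV mulmxA => /eqP ->; rewrite mulmx0 mxE.
right; apply/vspaceP => s; rewrite memvf -MW mem_ker_cV.
have := form s; rewrite lE l0 scale0r mulmx0 mul0mx mxE => /esym/eqP.
rewrite psumr_eq0 => [/allP/(_ set0 (mem_index_enum _))|A _]; last exact: sqnorm_cV_ge0.
by rewrite D0 /= mono0 mulmx1 => /eqP/sqnorm_cV_eq0 ->; rewrite eqxx.
Qed.

End InvariantForms.

(** * The dimension of the spinor module and its reducibility *)

Section SpinorDimension.
Context (R : realType) (p q : nat) (S : spinor_module R p q).
Hypothesis n_gt0 : (0 < p + q)%N.
Local Notation I := 'I_(p + q).
Local Notation N := (spinor_dim S).
Local Notation rho := (spinor_act S).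
Local Notation g := (mono rho).
Implicit Types (i j : I) (A B : {set I}) (X Y Z : 'M[R]_N) (s : 'cV[R]_N).
Implicit Types (W : {vspace 'cV[R]_N}).

Definition even_set A := ~~ odd #|A|.

Lemma even_set0 : even_set set0.
Proof. by rewrite /even_set cards0. Qed.

Lemma even_set_symdiff A B : even_set A -> even_set (symdiff A B) = even_set B.
Proof. by rewrite /even_set odd_symdiff => /negPf ->. Qed.

Lemma cl_stable_full W : cl_stable rho fullv W <-> mono_stable rho predT W.
Proof.
split=> [st A s _|st x s _ sW]; first by apply: st; apply: memvf.
rewrite rho_mono mulmx_suml; apply: memv_suml => A _.
by rewrite -scalemxAl memvZ // st.
Qed.

Lemma cl_stable_even W :
  cl_stable rho (cl_part R p q false) W <-> mono_stable rho even_set W.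
Proof.
split=> [st A s eA|st x s /memv_sumP[f fP ->] sW].
  by apply: st; have := cl_basis_part R A; rewrite (negPf eA).
rewrite linear_sum mulmx_suml; apply: memv_suml => A /eqP eA.
have /vlineP[a ->] := fP A (introT eqP eA); rewrite linearZ /= -scalemxAl memvZ //.
by apply: st; rewrite // /even_set eA.
Qed.

Lemma spinor_fullv_neq0 : (fullv : {vspace 'cV[R]_N}) != 0%VS.
Proof. by case: (spinor_irreducible S). Qed.

Lemma spinor_dim_gt0 : (0 < N)%N.
Proof.
have := spinor_fullv_neq0; rewrite -dimv_eq0 dimvf /dim /= muln1.
by rewrite lt0n.
Qed.

Lemma mono_irreducible_full : mono_irreducible rho predT.
Proof.
move=> W /cl_stable_full st; case: (spinor_irreducible S) => _ _.
by apply=> //; apply: subvf.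
Qed.

Lemma mono_irreducible_even : mono_irreducible rho even_set <-> ~ spinor_reducible S.
Proof.
rewrite /spinor_reducible notK; split=> [irr|[_ _ irr] W /cl_stable_even st].
  split; [exact: spinor_fullv_neq0|by move=> x s _ _; apply: memvf|].
  by move=> W _ /cl_stable_even/irr.
by apply: irr => //; apply: subvf.
Qed.

(** The volume element is central for odd [n]; when its square is [1] it acts
    as [1] or [-1], otherwise it is a complex structure. *)
Definition central_split := odd (p + q) && (cl_square R [set: I] == 1).

Lemma cl_squareN1 A : cl_square R A != 1 -> cl_square R A = -1.
Proof.
have := cl_square_sqr R A; rewrite -expr2 => /eqP; rewrite sqrf_eq1.
by case/orP => /eqP -> //; rewrite eqxx.
Qed.

Lemma mxtrace_mono_full : odd (p + q) ->
  (\tr (g [set: I])) ^+ 2 = (central_split%:R : R) * N%:R ^+ 2.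
Proof.
move=> on; rewrite /central_split on /=; case: eqP => [w1|/eqP/cl_squareN1 w1].
  have [|A _||->|->] := @mono_commute_involution R p q N rho predT (g setT).
  - exact: mono_irreducible_full.
  - apply: mono_commute1 => i.
    by rewrite mono_swap1 inE cardsT card_ord -signr_odd oddD on /= expr0 scale1r.
  - by rewrite mono_sqr w1.
  - by rewrite mxtrace1 mul1r.
  - by rewrite raddfN /= mxtrace1 sqrrN mul1r.
rewrite mxtrace_sqrN1 ?expr0n ?mul0r // mono_sqr w1.
by rewrite raddfN.
Qed.

Lemma sum_mxtrace_even : \sum_(A | even_set A) (\tr (g A)) ^+ 2 = N%:R ^+ 2.
Proof.
rewrite (bigD1 set0) ?even_set0 //= big1 ?addr0 ?mxtrace_mono0 // => A /andP[eA A0].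
by rewrite mxtrace_mono_even // expr0n.
Qed.

Lemma sum_mxtrace : \sum_(A : {set I}) (\tr (g A)) ^+ 2 =
  (1 + central_split%:R) * N%:R ^+ 2.
Proof.
rewrite (bigID even_set) /= sum_mxtrace_even mulrDl mul1r; congr (_ + _).
case on: (odd (p + q)); last first.
  rewrite /central_split on mul0r big1 // => A; rewrite /even_set negbK => oA.
  rewrite mxtrace_mono_odd ?expr0n //; apply: contraTneq oA => ->.
  by rewrite cardsT card_ord on.
rewrite -mxtrace_mono_full // (bigD1 setT) /= ?/even_set ?cardsT ?card_ord ?on //.
rewrite big1 ?addr0 // => A /andP[oA AT].
by rewrite mxtrace_mono_odd ?expr0n //; rewrite negbK in oA.
Qed.

(** Its real part is the sum of the squares of the even monomials, its
    imaginary part that of the odd ones. *)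
Definition gauss_pq : R[i] := (1 -i* 1)%C ^+ p * (1 +i* 1)%C ^+ q.

(** There is, up to a factor, exactly one symmetric form on [S] that is
    invariant under all monomials. *)
Lemma spinor_dim_equation :
  (1 + central_split%:R) * N%:R ^+ 2 +
    N%:R * (complex.Re gauss_pq + complex.Im gauss_pq) = 2 * 2 ^+ (p + q) :> R.
Proof.
have DM A B : predT A -> predT (symdiff A B) = predT B by [].
have := @dim_sym_inv R p q N rho predT isT DM.
have /(@dim_sym_inv_irreducible R p q N rho predT isT DM spinor_dim_gt0) -> := mono_irreducible_full.
rewrite mul1r sum_mxtrace (bigID even_set) /= sum_square_even.
rewrite (eq_bigl (fun A : {set I} => odd #|A|)) ?sum_square_odd => [<-|A]; last first.
  by rewrite /even_set negbK.
congr (_ * _); rewrite -natrX; congr (_%:R).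
by rewrite -[in RHS](card_ord (p + q)) -[in RHS]cardsT -card_powerset powersetT cardsT.
Qed.

Lemma card_even_set : 2 * #|even_set|%:R = 2 ^+ (p + q) :> R.
Proof. by rewrite -natrM mulnC card_even // natrX. Qed.

Lemma spinor_irreducible_equation :
  ~ spinor_reducible S <->
  N%:R ^+ 2 + N%:R * complex.Re gauss_pq = 2 ^+ (p + q) :> R.
Proof.
rewrite -mono_irreducible_even.
rewrite (@dim_sym_inv_irreducible R p q N rho _ even_set0 even_set_symdiff spinor_dim_gt0).
rewrite -sum_square_even -sum_mxtrace_even -dim_sym_inv; last 2 first.
- exact: even_set0.
- exact: even_set_symdiff.
have e0 : (2 ^+ (p + q) : R) != 0 by rewrite expf_neq0 // pnatr_eq0.
rewrite card_even_set; split=> [->|/eqP]; first by rewrite mul1r.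
rewrite -[X in _ == X]mul1r => /eqP/(mulIf e0)/eqP.
by rewrite -[1]/(1%:R) eqr_nat => /eqP.
Qed.

End SpinorDimension.

(** * Equivariant maps and invariant forms *)

Section EquivariantForms.
Context (R : realType) (p q : nat) (S : spinor_module R p q).
Local Notation I := 'I_(p + q).
Local Notation V := 'rV[R]_(p + q).
Local Notation N := (spinor_dim S).
Local Notation rho := (spinor_act S).
Local Notation g := (mono rho).
Local Notation e := (std_basis R).
Local Notation s_ := (pq_sign R).
Local Notation tw := (twist rho (pq_signs R (p:=p) (q:=q))).
Implicit Types (i k : I) (A B : {set I}) (X Y Z b : 'M[R]_N) (u v : V).

Lemma form_of_inj b c :
  (forall s t : 'cV[R]_N, form_of b s t = form_of c s t) -> b = c.
Proof.
move=> bc; apply/matrixP => i k.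
have := bc (delta_mx i 0) (delta_mx k 0).
by rewrite /form_of !trmx_delta -!rowE -!colE !mxE.
Qed.

Lemma form_of_mull b Y s t : form_of b (Y *m s) t = form_of (Y^T *m b) s t.
Proof. by rewrite /form_of trmx_mul !mulmxA. Qed.

Lemma form_of_mulr b Y s t : form_of b s (Y *m t) = form_of (b *m Y) s t.
Proof. by rewrite /form_of !mulmxA. Qed.

Lemma form_ofN b s t : form_of (- b) s t = - form_of b s t.
Proof. by rewrite /form_of mulmxN mulNmx mxE. Qed.

Lemma form_ofD b c s t : form_of (b + c) s t = form_of b s t + form_of c s t.
Proof. by rewrite /form_of mulmxDr mulmxDl mxE. Qed.

Lemma form_ofZ a b s t : form_of (a *: b) s t = a * form_of b s t.
Proof. by rewrite /form_of -scalemxAr -scalemxAl [LHS]mxE. Qed.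

Lemma form_of_tr b s t : form_of b^T s t = form_of b t s.
Proof.
rewrite /form_of (_ : s^T *m b^T *m t = (t^T *m b *m s)^T) 1?mxE //.
by rewrite !trmx_mul trmxK mulmxA.
Qed.

(** The bilinear forms invariant under [so(V)]; an even monomial multiplies
    them by the product of the norms of its factors. *)
Definition so_form b := twist_inv rho (@even_set p q) (pq_signs R (p:=p) (q:=q)) b.

Lemma twist1E i b : tw [set i] b = s_ i *: ((g [set i])^T *m b *m g [set i]).
Proof. by rewrite /twist /pq_signs big_set1. Qed.

Lemma twist1K i b : tw [set i] (tw [set i] b) = b.
Proof.
rewrite twistM; last exact: pq_signs_symdiff.
rewrite (_ : symdiff _ _ = set0); last by apply/setP => k; rewrite !inE addbb.
by rewrite /twist mono0 trmx1 mulmx1 mul1mx /pq_signs big_set0 scale1r.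
Qed.

Lemma twist1C i k b : tw [set i] (tw [set k] b) = tw [set k] (tw [set i] b).
Proof. by rewrite !twistM; try exact: pq_signs_symdiff; rewrite symdiffC. Qed.

(** Invariance under the products [e_i e_k] suffices, because they generate the
    even monomials. *)
Lemma so_form_twist1 b :
  so_form b <-> forall i k, tw [set i] b = tw [set k] b.
Proof.
split=> [ib i k|h].
  rewrite -[LHS](twist1K k) [tw [set k] (tw [set i] b)]twistM; last exact: pq_signs_symdiff.
  by rewrite ib // /even_set odd_symdiff !cards1.
have [i0 _|noI] := pickP (fun _ : I => true); last first.
  move=> A eA; rewrite (_ : A = set0); last by apply/setP => i; have := noI i.
  by rewrite /twist mono0 trmx1 mulmx1 mul1mx /pq_signs big_set0 scale1r.
suff h' A : tw A b = if odd #|A| then tw [set i0] b else b.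
  by move=> A eA; rewrite h' (negPf eA).
elim/cl_set_ind: A => [|i A iA IH].
  by rewrite cards0 /twist mono0 trmx1 mulmx1 mul1mx /pq_signs big_set0 scale1r.
rewrite cardsU1 iA -symdiff1 // symdiffC -twistM; last exact: pq_signs_symdiff.
rewrite IH /=; case: (odd _) => /=; last exact: h.
by rewrite (h i0 i) twist1K.
Qed.

Lemma so_form_skew b i k : so_form b -> i != k ->
  (g [set i] *m g [set k])^T *m b = - (b *m (g [set i] *m g [set k])).
Proof.
move=> /so_form_twist1 h ik.
have bE : s_ i * s_ k *: ((g [set i] *m g [set k])^T *m b *m (g [set i] *m g [set k])) = b.
  rewrite -[RHS](twist1K k) -(h i k) !twist1E -scalemxAr -scalemxAl scalerA mulrC.
  by rewrite trmx_mul !mulmxA.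
have gg : (g [set i] *m g [set k]) *m (g [set i] *m g [set k]) = - (s_ i * s_ k)%:M.
  rewrite mulmxA -[X in X *m _]mulmxA mono_swap1 inE (eq_sym k) (negPf ik) cards1 expr1.
  rewrite scaleN1r mulmxN mulNmx mulmxA mono_sqr -mulmxA mono_sqr -scalar_mxM.
  by rewrite !pq_sign_square1 mulrNN.
rewrite -{2}bE -scalemxAl -mulmxA gg mulmxN mul_mx_scalar scalerN scalerA.
by rewrite mulrACA !pq_signK mulr1 scale1r opprK.
Qed.

(** The form [b(v s, t)] as a function of [v]. *)
Definition clifford_form b v : 'M[R]_N := (rho (cl_vec v))^T *m b.

Fact clifford_form_linear b : linear (clifford_form b).
Proof.
move=> a u v; rewrite /clifford_form linearP (linearP rho) [(_ + _)^T]linearP.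
by rewrite mulmxDl -scalemxAl.
Qed.
HB.instance Definition _ b := GRing.isSemilinear.Build R V 'M[R]_N _
  (clifford_form b) (GRing.semilinear_linear (clifford_form_linear b)).

(** The linear map from [V] to the bilinear forms on [S] defined by [b]. *)
Definition bracket_of b : 'Hom(V, 'M[R]_N) := linfun (clifford_form b).

Lemma bracket_ofE b v : bracket_of b v = (rho (cl_vec v))^T *m b.
Proof. by rewrite lfunE. Qed.

Lemma rho_basis i : rho (cl_vec (e i)) = g [set i].
Proof. by rewrite cl_vec_basis. Qed.

Lemma bracket_of_basis b i : bracket_of b (e i) = (g [set i])^T *m b.
Proof. by rewrite bracket_ofE rho_basis. Qed.

Lemma bracket_eq (j j' : 'Hom(V, 'M[R]_N)) :
  (forall i, j (e i) = j' (e i)) -> j = j'.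
Proof.
move=> jj'; apply/lfunP => v; rewrite [v]row_sum_delta !linear_sum.
by apply: eq_bigr => i _; rewrite !linearZ /= -/(e i) jj'.
Qed.

Lemma bracket_of_linear : linear bracket_of.
Proof.
move=> a b c; apply: bracket_eq => i.
by rewrite add_lfunE scale_lfunE !bracket_of_basis mulmxDr -scalemxAr.
Qed.

Lemma so_equivariantE (j : 'Hom(V, 'M[R]_N)) :
  so_equivariant j <-> forall a : 'End(V), in_so a -> forall v,
    j (a v) = - ((rho (spin_of a))^T *m j v + j v *m rho (spin_of a)).
Proof.
split=> h a so_a v; last by move=> s t; rewrite h // form_of_mull form_of_mulr form_ofN form_ofD opprD.
by apply: form_of_inj => s t; rewrite h // form_of_mull form_of_mulr form_ofN form_ofD opprD.
Qed.

Lemma spin_of_skew (a : 'End(V)) b : in_so a -> so_form b ->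
  (rho (spin_of a))^T *m b = - (b *m rho (spin_of a)).
Proof.
move=> so_a ib.
have -> : spin_of a = \sum_i \sum_(k | k != i)
    (4^-1 * (s_ i * (a (e i)) 0 k)) *: (cl_basis R [set i] * cl_basis R [set k]).
  rewrite /spin_of scaler_sumr; apply: eq_bigr => i _.
  have aii : a (e i) 0 i = 0.
    have := so_a (e i) (e i); rewrite pq_formC pq_form_basisl => /eqP.
    rewrite -mulr2n mulrn_eq0 /= mulf_eq0 signr_eq0 /=; exact/eqP.
  rewrite cl_vec_basis [cl_vec (a _)]/cl_vec mulr_sumr (bigD1 i) //= aii scale0r mulr0 add0r.
  rewrite !scaler_sumr; apply: eq_bigr => k _.
  by rewrite -scalerAr !scalerA mulrA.
rewrite !linear_sum mulmx_suml /=; apply: eq_bigr => i _.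
rewrite !linear_sum mulmx_suml /=; apply: eq_bigr => k ki.
rewrite linearZ /= rmorphM [(_ *: _)^T]linearZ /= -scalemxAl -scalemxAr -scalerN.
by congr (_ *: _); rewrite so_form_skew // eq_sym.
Qed.

Lemma bracket_of_equivariant b : so_form b -> so_equivariant (bracket_of b).
Proof.
move=> ib; apply/so_equivariantE => a so_a v; rewrite !bracket_ofE.
rewrite -(spin_ofP so_a) linearB /= !rmorphM [(_ - _)^T]linearB /= mulmxBl !trmx_mul.
rewrite -mulmxA (spin_of_skew so_a ib) mulmxN mulmxA opprD addrC.
by rewrite !mulmxA.
Qed.

(** The infinitesimal rotation in the plane of [e_i] and [e_k]. *)
Definition rotation i k v : V :=
  (s_ i * v 0 i) *: e k - (s_ k * v 0 k) *: e i.

Fact rotation_linear i k : linear (rotation i k).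
Proof.
move=> a u v; rewrite /rotation !mxE; apply/rowP => l; rewrite !mxE; ring.
Qed.
HB.instance Definition _ i k := GRing.isSemilinear.Build R V V _
  (rotation i k) (GRing.semilinear_linear (rotation_linear i k)).

Definition rotation_so i k : 'End(V) := linfun (rotation i k).

Lemma rotation_in_so i k : in_so (rotation_so i k).
Proof.
move=> x y; rewrite !lfunE /= /rotation.
have h (a c : R) (u w z : V) : pq_form (a *: u - c *: w) z = a * pq_form u z - c * pq_form w z.
  by rewrite -scaleNr addrC (pq_form_linearl z (- c)) -[a *: u]addr0
    (pq_form_linearl z a) mulNr addrC (_ : pq_form 0 z = 0) ?addr0 //
    pq_formE big1 // => l _; rewrite mxE mul0r mulr0.
rewrite (pq_formC x) !h !pq_form_basisl; ring.
Qed.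

Lemma rotation_so_basis i k : i != k -> rotation_so i k (e i) = s_ i *: e k.
Proof.
move=> ik; rewrite lfunE /= /rotation !mxE !eqxx (eq_sym k) (negPf ik) /=.
by rewrite mulr1 mulr0 scale0r subr0.
Qed.

Lemma spin_of_rotation i k : i != k ->
  spin_of (rotation_so i k) = 2^-1 *: (cl_basis R [set i] * cl_basis R [set k]).
Proof.
move=> ik; rewrite /spin_of.
have ra l : rotation_so i k (e l) = (s_ i * (l == i)%:R) *: e k - (s_ k * (l == k)%:R) *: e i.
  by rewrite lfunE /= /rotation !mxE eqxx /= (eq_sym i) (eq_sym k).
rewrite (bigD1 i) //= (bigD1 k) 1?eq_sym //= big1 => [|l /andP[li lk]]; last first.
  by rewrite ra (negPf li) (negPf lk) !mulr0 !scale0r subrr linear0 mulr0 scaler0.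
rewrite addr0 !ra !eqxx (negPf ik) (eq_sym k) (negPf ik) !mulr0 !scale0r subr0 add0r !mulr1.
rewrite [cl_vec (- _)]linearN /= [cl_vec (s_ i *: _)]linearZ [cl_vec (s_ k *: _)]linearZ /= !cl_vec_basis mulrN -!scalerAr scalerN !scalerA !pq_signK !scale1r.
have := cl_basis_anticomm R i k.
rewrite pq_form_basisl mxE (negPf ik) andbF !mulr0 scale0r => /eqP.
rewrite addr_eq0 => /eqP <-; rewrite -mulr2n -scaler_nat scalerA; congr (_ *: _).
by field.
Qed.

(** Rotating [e_i] into [e_k] shows that the forms [b] with
    [j(e_i) (s, t) = b(e_i s, t)] do not depend on [i], and are invariant. *)
Lemma so_equivariant_bracket (j : 'Hom(V, 'M[R]_N)) i0 : so_equivariant j ->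
  exists2 b, so_form b & j = bracket_of b.
Proof.
move=> /so_equivariantE jE.
pose b i := cl_square R [set i] *: ((g [set i])^T *m j (e i)).
have jb i : j (e i) = (g [set i])^T *m b i.
  rewrite /b -scalemxAr mulmxA mono_tr_mulmx mul_scalar_mx scalerA.
  by rewrite cl_square_sqr scale1r.
(* The value on [e_i] of the equivariance under the rotation in the plane of
   [e_i] and [e_k]. *)
have bk i k : i != k -> b k = 2^-1 *: (b i + tw [set k] (tw [set i] (b i))).
  move=> ik; have := jE _ (rotation_in_so i k) (e i).
  rewrite rotation_so_basis // spin_of_rotation // linearZ [rho _]linearZ /= rmorphM /=.
  rewrite -/(g [set i]) -/(g [set k]) => h.
  have {}h : j (e k) = s_ i *: - ((2^-1 *: (g [set i] *m g [set k]))^T *m j (e i) +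
      j (e i) *m (2^-1 *: (g [set i] *m g [set k]))).
    transitivity (s_ i *: (s_ i *: j (e k))); first by rewrite scalerA pq_signK scale1r.
    by rewrite h.
  have e1 : (g [set k])^T *m ((g [set i] *m g [set k])^T *m ((g [set i])^T *m b i)) =
      (cl_square R [set k] * cl_square R [set i]) *: b i.
    rewrite trmx_mul !mulmxA mono_tr_mulmx -[_ *m _ *m (g [set i])^T]mulmxA mono_tr_mulmx.
    by rewrite -scalar_mxM mul_scalar_mx.
  have e2 : (g [set k])^T *m ((g [set i])^T *m b i *m (g [set i] *m g [set k])) =
      (s_ k * s_ i) *: tw [set k] (tw [set i] (b i)).
    rewrite !twist1E -[(g [set k])^T *m (_ *: _)]scalemxAr -scalemxAl !scalerA.
    by rewrite -mulrA mulrCA mulrA mulrA !pq_signK mul1r pq_signK scale1r !mulmxA.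
  have half X Y : (2^-1 *: X)^T *m Y + Y *m (2^-1 *: X) = 2^-1 *: (X^T *m Y + Y *m X).
    by rewrite [(2^-1 *: X)^T]linearZ /= -scalemxAl -scalemxAr scalerDr.
  rewrite {1}/b h half jb -scalemxAr mulmxN -scalemxAr mulmxDr e1 e2.
  have -> : s_ k = - cl_square R [set k] by apply: pq_sign_square1.
  have -> : s_ i = - cl_square R [set i] by apply: pq_sign_square1.
  rewrite mulrNN -scalerDr scaleNr !scalerN opprK !scalerA; congr (_ *: _).
  transitivity (2^-1 * (cl_square R [set k] * cl_square R [set k]) *
      (cl_square R [set i] * cl_square R [set i])); first by ring.
  by rewrite !cl_square_sqr !mulr1.
clearbody b.
(* By [bk], [b k] is fixed by the involution [tw [set k] \o tw [set i]]. *)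
have tE i k : i != k -> tw [set i] (b k) = tw [set k] (b k).
  move=> ik; rewrite -[LHS](twist1K k); congr (tw _ _).
  rewrite (bk i k ik) [tw [set i] (2^-1 *: _)]twistZ [tw [set k] (2^-1 *: _)]twistZ.
  rewrite [tw [set i] (_ + _)]twistD [tw [set k] (_ + _)]twistD.
  rewrite (twist1C i k (tw _ _)) !twist1K.
  by congr (_ *: _); rewrite addrC.
have bE i k : b i = b k.
  have [->//|ik] := eqVneq i k.
  rewrite (bk i k ik) -(tE k i) 1?eq_sym // twist1K -mulr2n -scaler_nat scalerA.
  by rewrite mulVf ?scale1r // pnatr_eq0.
exists (b i0); last by apply: bracket_eq => i; rewrite bracket_of_basis jb (bE i i0).
apply/so_form_twist1 => i k; have [->//|ik] := eqVneq i k.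
by rewrite (bE i0 k) tE.
Qed.

End EquivariantForms.

(** * Symmetry of the forms *)

Section BracketDimensions.
Context (R : realType) (p q : nat) (S : spinor_module R p q).
Hypothesis n_gt0 : (0 < p + q)%N.
Local Notation I := 'I_(p + q).
Local Notation V := 'rV[R]_(p + q).
Local Notation N := (spinor_dim S).
Local Notation rho := (spinor_act S).
Local Notation g := (mono rho).
Local Notation e := (std_basis R).
Local Notation s_ := (pq_sign R).
Local Notation tw := (twist rho (pq_signs R (p:=p) (q:=q))).
Local Notation av := (average rho (@even_set p q) (pq_signs R (p:=p) (q:=q))).
Implicit Types (i k : I) (A B : {set I}) (X Y Z b : 'M[R]_N) (u v : V).

Let i0 : I := Ordinal n_gt0.

Lemma so_form_average X : so_form (av X).
Proof. by apply: average_inv; [exact: even_set_symdiff|exact: pq_signs_symdiff]. Qed.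

Lemma so_form_id b : so_form b -> av b = b.
Proof. by move=> ib; apply: average_id => //; apply: even_set0. Qed.

Lemma so_form_comb a c b b' : so_form b -> so_form b' -> so_form (a *: (b + c *: b')).
Proof.
move=> ib ib' A eA.
by rewrite [LHS]twistZ [tw A (_ + _)]twistD [tw A (c *: _)]twistZ ib ?ib'.
Qed.

Lemma linear_comb a c (f h : 'M[R]_N -> 'M[R]_N) : linear f -> linear h ->
  linear (fun X => a *: (f X + c *: h X)).
Proof.
move=> fl hl d X Y; rewrite fl hl [c *: (_ + _)]scalerDr addrACA scalerA (mulrC c) -scalerA.
by rewrite -scalerDr [LHS]scalerDr [a *: (d *: _)]scalerA (mulrC a) -scalerA.
Qed.

(** The dimension of a space of equivariant maps is the trace of a projector of
    the space of forms: up to a sign, [j -> e_0^T j(e_0)] inverts [bracket_of]. *)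
Lemma dim_bracket (U : {vspace 'Hom(V, 'M[R]_N)}) (P : 'M[R]_N -> 'M[R]_N) :
  linear P -> (forall j, j \in U -> so_equivariant j) ->
  (forall X, bracket_of (P X) \in U) ->
  (forall b, so_form b -> bracket_of b \in U -> P b = b) ->
  (\dim U)%:R = optrace P.
Proof.
move=> Plin UJ PU Pid.
pose a (j : 'Hom(V, 'M[R]_N)) := cl_square R [set i0] *: ((g [set i0])^T *m j (e i0)).
have aK b : a (bracket_of b) = b.
  rewrite /a bracket_of_basis mulmxA mono_tr_mulmx mul_scalar_mx scalerA.
  by rewrite cl_square_sqr scale1r.
rewrite (@dim_retract R N _ U a (fun X => bracket_of (P X))) //.
- by apply: eq_optrace => X; rewrite aK.
- move=> c j j'; rewrite /a add_lfunE scale_lfunE mulmxDr scalerDr -scalemxAr.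
  by rewrite !scalerA mulrC.
- by move=> c X Y; rewrite Plin bracket_of_linear.
- move=> j jU; have [b bf jb] := so_equivariant_bracket i0 (UJ j jU).
  by rewrite jb aK Pid // -jb.
Qed.

Lemma bracket_of_inj b c : bracket_of b = bracket_of c -> b = c.
Proof.
move=> bc; have /(congr1 (mulmx (g [set i0])^T)) : (g [set i0])^T *m b = (g [set i0])^T *m c.
  by rewrite -!bracket_of_basis bc.
rewrite !mulmxA mono_tr_mulmx !mul_scalar_mx; apply: scalerI; exact: cl_square_neq0.
Qed.

Lemma bracket_ofZ a b : bracket_of (a *: b) = a *: bracket_of b.
Proof.
by apply: bracket_eq => i; rewrite scale_lfunE !bracket_of_basis -scalemxAr.
Qed.

(** Exchanging the two spinor arguments of [b(v s, t)] replaces [b] by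
    [flip b]. *)
Definition flip b := - tw [set i0] b^T.

Lemma flip_linear : linear flip.
Proof.
move=> a X Y; rewrite /flip [(_ + _)^T]linearP /= twist_linear.
by rewrite opprD scalerN.
Qed.

Lemma flipK : involutive flip.
Proof.
move=> b; rewrite /flip [in (- _)^T]twist_tr [(- _)^T]linearN /= trmxK.
by rewrite -[- tw _ b]scaleN1r [tw _ (_ *: _)]twistZ scaleN1r opprK twist1K.
Qed.

Lemma so_form_tr b : so_form b -> so_form b^T.
Proof. by move=> ib A eA; rewrite twist_tr ib. Qed.

Lemma so_form_flip b : so_form b -> so_form (flip b).
Proof.
move=> ib A eA; rewrite /flip -scaleN1r twistZ twistM; last exact: pq_signs_symdiff.
rewrite symdiffC -twistM; last exact: pq_signs_symdiff.
by rewrite so_form_tr.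
Qed.

Lemma bracket_of_tr b v : so_form b -> (bracket_of b v)^T = bracket_of (flip b) v.
Proof.
move=> ib; rewrite [v]row_sum_delta !linear_sum; apply: eq_bigr => i _.
rewrite !linearZ /= -/(e i); congr (_ *: _); rewrite !bracket_of_basis trmx_mul trmxK.
have /so_form_twist1 h := so_form_tr ib.
rewrite /flip (h i0 i) twist1E -scaleNr -scalemxAr !mulmxA mono_tr_mulmx mul_scalar_mx.
by rewrite -!scalemxAl scalerA pq_sign_square1 opprK cl_square_sqr scale1r.
Qed.

Lemma has_symmetryE sigma b : so_form b ->
  has_symmetry sigma (bracket_of b) <-> flip b = (-1) ^+ sigma *: b.
Proof.
move=> ib; split=> [h|h v s t]; last first.
  by rewrite -form_of_tr bracket_of_tr // h bracket_ofZ scale_lfunE form_ofZ.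
apply: bracket_of_inj; apply/lfunP => v; rewrite bracket_ofZ scale_lfunE -bracket_of_tr //.
by apply: form_of_inj => s t; rewrite form_of_tr h form_ofZ.
Qed.

Lemma optrace_av : optrace (fun X => av X) = (#|@even_set p q|%:R)^-1 * N%:R ^+ 2.
Proof.
rewrite optrace_average (bigD1 set0) ?even_set0 //= big1 ?addr0 => [|A /andP[eA A0]].
  by rewrite mxtrace_mono0 /pq_signs big_set0 mul1r.
by rewrite mxtrace_mono_even // expr0n mulr0.
Qed.

Lemma mono_mul_sqr A i : (g A *m g [set i]) *m (g A *m g [set i]) =
  (cl_square R (symdiff A [set i]))%:M.
Proof.
by rewrite monoM -scalemxAl -scalemxAr scalerA cl_signK scale1r mono_sqr.
Qed.

(** Summing over the odd monomials [e_A e_0]. *)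
Lemma sum_even_odd (f : {set I} -> R) :
  \sum_(A | even_set A) f (symdiff A [set i0]) = \sum_(A : {set I} | odd #|A|) f A.
Proof.
rewrite [RHS](reindex_inj (can_inj (symdiffK [set i0]))) /=; apply: eq_big => A.
  by rewrite /even_set odd_symdiff cards1.
by move=> _; rewrite symdiffC.
Qed.

(** The sum of [(-1)^((k - 1) / 2)] over the odd monomials, [k] being the number
    of factors. *)
Definition odd_sum : R := complex.Im ((1 +i* 1)%C ^+ (p + q)).

Lemma optrace_flip_av :
  optrace (fun X => flip (av X)) = (#|@even_set p q|%:R)^-1 * (N%:R * odd_sum).
Proof.
rewrite (eq_optrace (g := fun X => - s_ i0 *: ((g [set i0])^T *m (av X)^T *m g [set i0]))).
  rewrite optraceZ optrace_average_mulmx_tr mulrCA; congr (_ * _).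
  rewrite /odd_sum -[complex.Im _]opprK -sum_signs_square_odd -sum_even_odd mulNr mulrN; congr (- _).
  rewrite !mulr_sumr; apply: eq_bigr => A _.
  rewrite -!mulmxA mulmxA mono_mul_sqr mxtrace_scalar pq_signs_symdiff.
  rewrite [pq_signs R [set i0]]big_set1 -mulr_natl; ring.
by move=> X; rewrite /flip twist1E scaleNr.
Qed.

(** Averaging over an involution [f] with the sign [c] lands in the eigenspace
    of [f] for [c]. *)
Lemma sign_invol (c : R) (f : 'M[R]_N -> 'M[R]_N) X : linear f -> involutive f -> c * c = 1 ->
  f (2^-1 *: (X + c *: f X)) = c *: (2^-1 *: (X + c *: f X)).
Proof.
move=> fl fK cc; have fZ a Y : f (a *: Y) = a *: f Y.
  have f0 : f 0 = 0 by have := fl (-1) 0 0; rewrite scaler0 addr0 scaleN1r addNr.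
  by have := fl a Y 0; rewrite f0 !addr0.
have fD Y Z : f (Y + Z) = f Y + f Z by rewrite -{1}[Y]scale1r fl scale1r.
rewrite fZ fD fZ fK [RHS]scalerA [c * _]mulrC -[RHS]scalerA [c *: (_ + _)]scalerDr.
by rewrite [c *: (c *: _)]scalerA cc scale1r addrC.
Qed.

(** [L^sigma = (N^2 + sigma N Im ((1 + i)^n)) / 2^n]. *)
Lemma L1_formula sigma :
  (L1 S sigma)%:R * 2 ^+ (p + q) = N%:R ^+ 2 + (-1) ^+ sigma * (N%:R * odd_sum).
Proof.
pose P X := 2^-1 *: (av X + (-1) ^+ sigma *: flip (av X)).
have avl := average_linear rho (@even_set p q) (pq_signs R (p:=p) (q:=q)).
have signK : (-1) ^+ sigma * (-1) ^+ sigma = 1 :> R by rewrite -expr2 sqrr_sign.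
rewrite /L1 (@dim_bracket _ P) //.
- rewrite optraceZ (optraceD (fun X => av X)) (optraceZ _ (fun X => flip (av X))).
  rewrite optrace_av optrace_flip_av.
  rewrite -(card_even_set R n_gt0); have := card_D_neq0 R (even_set0 p q).
  set m := _%:R => m0; field; exact: m0.
- by apply: linear_comb => // a X Y; rewrite avl flip_linear.
- by move=> j /mem_J1[/mem_J].
- move=> X; have sP : so_form (P X).
    by apply: so_form_comb; [|apply: so_form_flip]; apply: so_form_average.
  apply/mem_J1; split; first exact/mem_J/bracket_of_equivariant.
  by apply/has_symmetryE => //; apply: sign_invol => //; [exact: flip_linear|exact: flipK].
- move=> b ib /mem_J1[_ /(has_symmetryE _ ib) fb].
  rewrite /P so_form_id // fb scalerA signK scale1r -mulr2n -scaler_nat scalerA.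
  by rewrite mulVf ?scale1r // pnatr_eq0.
Qed.

End BracketDimensions.

(** * Semispinors *)

Section SemispinorGrading.
Context (R : realType) (p q : nat) (S : spinor_module R p q).
Hypothesis n_gt0 : (0 < p + q)%N.
Local Notation I := 'I_(p + q).
Local Notation V := 'rV[R]_(p + q).
Local Notation N := (spinor_dim S).
Local Notation rho := (spinor_act S).
Local Notation g := (mono rho).
Local Notation e := (std_basis R).
Local Notation s_ := (pq_sign R).
Local Notation tw := (twist rho (pq_signs R (p:=p) (q:=q))).
Local Notation av := (average rho (@even_set p q) (pq_signs R (p:=p) (q:=q))).
Implicit Types (i k : I) (A B : {set I}) (X Y Z b : 'M[R]_N).
Implicit Types (s t : 'cV[R]_N).

Let i0 : I := Ordinal n_gt0.

(** [E] is [1] on [Sp] and [-1] on [Sm]. *)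
Definition grading (Sp Sm : {vspace 'cV[R]_N}) (E : 'M[R]_N) : Prop :=
  [/\ E *m E = 1%:M,
      forall A, even_set A -> g A *m E = E *m g A,
      forall i, g [set i] *m E = - (E *m g [set i]),
      forall s, s \in Sp <-> E *m s = s
    & forall s, s \in Sm <-> E *m s = - s].

(** Products with [e_i] exchange [Sp] and [Sm]: from [Sp] to [Sm] by the choice
    of [Sm], and back because an odd element times an odd one is even. *)
Lemma semispinors_grading Sp Sm : semispinors S Sp Sm -> exists E, grading Sp Sm E.
Proof.
case=> [[_ stp _] [_ stm _] SpSm dir SmE].
have [E Ef] := matrix_of_lfun (daddv_pi Sp Sm - daddv_pi Sm Sp).
have dir' : (Sm :&: Sp)%VS = 0%VS by rewrite capvC.
have Ep s : s \in Sp -> E *m s = s.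
  move=> sp; rewrite Ef add_lfunE opp_lfunE daddv_pi_id //.
  have := daddv_pi_add dir (_ : s \in (Sp + Sm)%VS); rewrite SpSm memvf => /(_ isT).
  rewrite daddv_pi_id // -[RHS]addr0 => /addrI ->; by rewrite subr0.
have Em s : s \in Sm -> E *m s = - s.
  move=> sm; rewrite Ef add_lfunE opp_lfunE (daddv_pi_id dir') //.
  have := daddv_pi_add dir (_ : s \in (Sp + Sm)%VS); rewrite SpSm memvf => /(_ isT).
  rewrite (daddv_pi_id dir') // -[RHS]add0r => /addIr ->; by rewrite add0r.
have dec s : exists u v, [/\ u \in Sp, v \in Sm & s = u + v].
  have /memv_addP[u uS [v vS ->]] : s \in (Sp + Sm)%VS by rewrite SpSm memvf.
  by exists u, v.
have dbl0 s : s = - s -> s = 0.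
  move=> h; have : (2 : R) *: s == 0 by rewrite scaler_nat mulr2n {1}h addNr.
  by rewrite scaler_eq0 pnatr_eq0 => /eqP.
have gp A s : even_set A -> s \in Sp -> g A *m s \in Sp.
  by move=> eA; exact: ((cl_stable_even Sp).1 stp A s eA).
have gm A s : even_set A -> s \in Sm -> g A *m s \in Sm.
  by move=> eA; exact: ((cl_stable_even Sm).1 stm A s eA).
have g1p i s : s \in Sp -> g [set i] *m s \in Sm.
  move=> sp; rewrite SmE; have /cl_translateP := subvv (cl_translate rho (cl_part R p q true) Sp).
  by apply=> //; rewrite -cl_vec_basis; apply: cl_vec_odd.
have g1m i s : s \in Sm -> g [set i] *m s \in Sp.
  have : (Sm <= (linfun (mulmx (g [set i])) @^-1: Sp))%VS.
    rewrite SmE; apply/cl_translateP => x u xo uS; rewrite -memv_preim lfunE /=.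
    rewrite mulmxA -[_ *m rho x](rmorphM rho); apply: stp => //.
    by apply: (@cl_partM _ _ _ true true) => //; rewrite -cl_vec_basis; apply: cl_vec_odd.
  by move=> /subvP h /h; rewrite -memv_preim lfunE.
exists E; split.
- apply: mulmx_cV_inj => s; have [u [v [uS vS ->]]] := dec s.
  by rewrite mul1mx -mulmxA !mulmxDr (Ep u) // (Em v) // mulmxN Ep // Em // opprK.
- move=> A eA; apply: mulmx_cV_inj => s; have [u [v [uS vS ->]]] := dec s.
  rewrite -!mulmxA !mulmxDr (Ep u) // (Em v) // mulmxN.
  by rewrite (Ep (_ *m u)) ?gp // (Em (_ *m v)) // gm.
- move=> i; apply: mulmx_cV_inj => s; have [u [v [uS vS ->]]] := dec s.
  rewrite mulNmx -!mulmxA !mulmxDr (Ep u) // (Em v) // mulmxN.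
  by rewrite (Em (_ *m u)) ?g1p // (Ep (_ *m v)) ?g1m // opprD opprK.
- move=> s; split=> [/Ep//|]; have [u [v [uS vS ->]]] := dec s.
  rewrite mulmxDr Ep // Em // => /addrI/esym/dbl0 ->; by rewrite addr0.
- move=> s; split=> [/Em//|]; have [u [v [uS vS ->]]] := dec s.
  rewrite mulmxDr Ep // Em // opprD => /addIr/dbl0 ->; by rewrite add0r.
Qed.

Section Grading.
Variables (Sp Sm : {vspace 'cV[R]_N}) (E : 'M[R]_N).
Hypothesis gE : grading Sp Sm E.

Let EE : E *m E = 1%:M. Proof. by case: gE. Qed.

(** For [iota = +] both summands of [S = Sp + Sm] are orthogonal iff [E]
    preserves the form; for [iota = -] both are isotropic iff [E] reverses its
    sign. *)
Lemma has_isotropyE iota (j : 'Hom(V, 'M[R]_N)) :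
  has_isotropy Sp Sm iota j <-> forall v, E^T *m j v *m E = (-1) ^+ iota *: j v.
Proof.
have [_ _ _ pE mE] := gE.
have form0 b s t u : form_of b s (t + u) = form_of b s t + form_of b s u.
  by rewrite /form_of mulmxDr mxE.
have form1 b s t u : form_of b (s + u) t = form_of b s t + form_of b u t.
  by rewrite /form_of linearD !mulmxDl mxE.
have form0N b s t : form_of b s (- t) = - form_of b s t.
  by rewrite /form_of mulmxN mxE.
have form1N b s t : form_of b (- s) t = - form_of b s t.
  by rewrite /form_of linearN !mulNmx mxE.
have inp s : s + E *m s \in Sp.
  by apply/pE; rewrite mulmxDr mulmxA EE mul1mx addrC.
have inm s : s - E *m s \in Sm.
  by apply/mE; rewrite mulmxDr mulmxN mulmxA EE mul1mx opprB addrC.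
have fE v : (E^T *m j v *m E = (-1) ^+ iota *: j v) <->
    forall s t, form_of (j v) (E *m s) (E *m t) = (-1) ^+ iota * form_of (j v) s t.
  split=> [h s t|h]; last first.
    by apply: form_of_inj => s t; rewrite -form_of_mulr -form_of_mull h form_ofZ.
  by rewrite form_of_mulr form_of_mull -form_ofZ -h mulmxA.
split=> [h v|h].
  apply/fE => s t; case: iota h {fE} => h.
    have := h v (s + E *m s) (t + E *m t) (or_introl (conj (inp s) (inp t))).
    have := h v (s - E *m s) (t - E *m t) (or_intror (conj (inm s) (inm t))).
    by rewrite !(form0, form1, form0N, form1N); lra.
  have := h v (s + E *m s) (t - E *m t) (or_introl (conj (inp s) (inm t))).
  have := h v (s - E *m s) (t + E *m t) (or_intror (conj (inm s) (inp t))).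
  by rewrite !(form0, form1, form0N, form1N); lra.
case: iota h fE => h fE v s t st; have /fE/(_ s t) := h v.
  case: st => [[/pE -> /pE ->]|[/mE -> /mE ->]]; rewrite ?(form0N, form1N); lra.
case: st => [[/pE -> /mE ->]|[/mE -> /pE ->]]; rewrite ?(form0N, form1N); lra.
Qed.

(** On the forms [b(v s, t)] the grading acts through [b -> - E^T b E], as [E]
    anticommutes with [v]. *)
Definition regrade b := - (E^T *m b *m E).

Lemma regrade_linear : linear regrade.
Proof.
move=> a X Y; rewrite /regrade mulmxDr mulmxDl -scalemxAr -scalemxAl.
by rewrite opprD scalerN.
Qed.

Lemma regradeK : involutive regrade.
Proof.
move=> b; rewrite /regrade mulmxN mulNmx opprK -[RHS]mulmx1 -EE.
rewrite -[RHS]mul1mx -[X in X *m (_ *m _)]trmx1 -[in X in _ = X *m _]EE trmx_mul.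
by rewrite !mulmxA.
Qed.

Lemma so_form_regrade b : so_form b -> so_form (regrade b).
Proof.
have [_ gEe _ _ _] := gE; move=> ib A eA; rewrite -[in RHS](ib A eA) /twist /regrade.
rewrite mulmxN mulNmx scalerN -scalemxAr -scalemxAl; congr (- (_ *: _)).
have -> : (g A)^T *m (E^T *m b *m E) *m g A = (E *m g A)^T *m b *m (E *m g A).
  by rewrite trmx_mul !mulmxA.
by rewrite -gEe // trmx_mul !mulmxA.
Qed.

Lemma bracket_of_regrade b (v : V) :
  E^T *m bracket_of b v *m E = bracket_of (regrade b) v.
Proof.
have [_ _ gEo _ _] := gE.
rewrite [v]row_sum_delta !linear_sum mulmx_suml; apply: eq_bigr => i _.
rewrite !linearZ /= -scalemxAl; congr (_ *: _); rewrite -/(e i) !bracket_of_basis /regrade.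
by rewrite mulmxN !mulmxA -!trmx_mul gEo [(- _)^T]linearN /= !mulNmx.
Qed.

Lemma has_isotropy_bracket iota b :
  has_isotropy Sp Sm iota (bracket_of b) <-> regrade b = (-1) ^+ iota *: b.
Proof.
rewrite has_isotropyE; split=> [h|h v]; last first.
  by rewrite bracket_of_regrade h bracket_ofZ scale_lfunE.
apply: (bracket_of_inj n_gt0); apply/lfunP => v.
by rewrite bracket_ofZ scale_lfunE -bracket_of_regrade h.
Qed.

Lemma flip_regrade b : flip n_gt0 (regrade b) = regrade (flip n_gt0 b).
Proof.
have [_ _ gEo _ _] := gE.
have gg Y : (g [set i0])^T *m (E^T *m Y *m E) *m g [set i0] =
    E^T *m ((g [set i0])^T *m Y *m g [set i0]) *m E.
  have -> : (g [set i0])^T *m (E^T *m Y *m E) *m g [set i0] =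
      (E *m g [set i0])^T *m Y *m (E *m g [set i0]) by rewrite trmx_mul !mulmxA.
  have -> : E *m g [set i0] = - (g [set i0] *m E) by rewrite gEo opprK.
  by rewrite [(- _)^T]linearN /= !mulNmx mulmxN opprK trmx_mul !mulmxA.
have tE : (- (E^T *m b *m E))^T = - (E^T *m b^T *m E).
  by rewrite [(- _)^T]linearN /= !trmx_mul trmxK mulmxA.
rewrite /flip /regrade tE !twist1E mulmxN mulNmx gg scalerN opprK.
by rewrite mulmxN mulNmx opprK -scalemxAr -scalemxAl.
Qed.

(** The trace of [regrade] on the invariant forms, times the number of even
    monomials. *)
Definition grading_sum : R :=
  - \sum_(A | even_set A) pq_signs R A * (\tr (g A *m E)) ^+ 2.

(** Only the volume element contributes, as the other [g A *m E] anticommute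
    with some [e_i]. *)
Lemma grading_sumE : grading_sum =
  - ((~~ odd (p + q) && (cl_square R [set: I] == 1))%:R * pq_signs R [set: I] * N%:R ^+ 2).
Proof.
have [_ gEe gEo _ _] := gE.
have notfull A : even_set A -> A != setT -> \tr (g A *m E) = 0.
  rewrite -properT => eA /properP[_ [i _ iA]].
  apply: (mxtrace_anticomm (cl_square_neq0 R [set i]) (mono_sqr rho _)).
  rewrite mulmxA mono_swap1 (negPf iA) addn0 -signr_odd (negPf eA) expr0 scale1r.
  by rewrite -!mulmxA gEo mulmxN opprK.
rewrite /grading_sum; congr (- _); case on: (odd (p + q)) => /=.
  rewrite !mul0r big1 // => A eA; rewrite notfull ?expr0n ?mulr0 //.
  by apply: contraNneq eA => ->; rewrite cardsT card_ord on.
have eT : @even_set p q setT by rewrite /even_set cardsT card_ord on.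
rewrite (bigD1 setT) //= big1 => [|A /andP[eA AT]]; last first.
  by rewrite notfull ?expr0n ?mulr0.
rewrite addr0 mulrC [RHS]mulrAC; congr (_ * _).
have XX : (g setT *m E) *m (g setT *m E) = (cl_square R [set: I])%:M.
  by rewrite mulmxA -(mulmxA (g setT) E) -gEe // mulmxA -mulmxA EE mulmx1 mono_sqr.
case: eqP => [w1|/eqP/cl_squareN1 w1].
  have [|A _||->|->] := @mono_commute_involution R p q N rho predT (g setT *m E).
  - exact: mono_irreducible_full.
  - apply: mono_commute1 => i; rewrite mulmxA mono_swap1 inE cardsT card_ord.
    by rewrite -signr_odd oddD on /= expr1 scaleN1r mulNmx -!mulmxA gEo mulmxN opprK.
  - by rewrite XX w1.
  - by rewrite mxtrace1 mul1r.
  - by rewrite raddfN /= mxtrace1 sqrrN mul1r.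
rewrite mxtrace_sqrN1 ?expr0n ?mul0r // XX w1.
by rewrite raddfN.
Qed.

Lemma optrace_regrade_av :
  optrace (fun X => regrade (av X)) = (#|@even_set p q|%:R)^-1 * grading_sum.
Proof.
rewrite (eq_optrace (g := fun X => -1 *: (E^T *m av X *m E))); last first.
  by move=> X; rewrite scaleN1r.
by rewrite optraceZ optrace_average_mulmx trmxK mulN1r -mulrN.
Qed.

(** [flip] and [regrade \o flip] have the same trace, because
    [E e_A e_0 E = - e_A e_0] for [A] even; hence [L^(+-) = L^(--)]. *)
Lemma optrace_regrade_flip_av :
  optrace (fun X => regrade (flip n_gt0 (av X))) =
  (#|@even_set p q|%:R)^-1 * (N%:R * odd_sum R p q).
Proof.
have [_ gEe gEo _ _] := gE.
rewrite -optrace_flip_av //.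
rewrite (eq_optrace (g := fun X =>
  s_ i0 *: ((g [set i0] *m E)^T *m (av X)^T *m (g [set i0] *m E)))); last first.
  move=> X; rewrite /regrade /flip twist1E mulmxN mulNmx opprK -scalemxAr -scalemxAl.
  by rewrite trmx_mul !mulmxA.
rewrite [RHS](eq_optrace (g := fun X => - s_ i0 *:
  ((g [set i0])^T *m (av X)^T *m g [set i0]))); last first.
  by move=> X; rewrite /flip twist1E scaleNr.
rewrite !optraceZ !optrace_average_mulmx_tr mulNr -mulrN -[in RHS]mulrN -sumrN.
congr (_ * (_ * _)); apply: eq_bigr => A eA; rewrite -mulrN; congr (_ * _).
rewrite -raddfN /=; congr (\tr _).
have -> : g A *m (g [set i0] *m E) *m g A *m (g [set i0] *m E) =
    g A *m g [set i0] *m (E *m g A) *m (g [set i0] *m E) by rewrite !mulmxA.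
rewrite -gEe //.
have -> : g A *m g [set i0] *m (g A *m E) *m (g [set i0] *m E) =
    g A *m g [set i0] *m g A *m (E *m g [set i0]) *m E by rewrite !mulmxA.
have -> : E *m g [set i0] = - (g [set i0] *m E) by rewrite gEo opprK.
by rewrite mulmxN mulNmx -!mulmxA EE mulmx1.
Qed.

Lemma L2_formula sigma iota :
  (L2 S Sp Sm sigma iota)%:R * (2 * 2 ^+ (p + q)) =
  N%:R ^+ 2 + (-1) ^+ sigma * (N%:R * odd_sum R p q) +
  (-1) ^+ iota * (grading_sum + (-1) ^+ sigma * (N%:R * odd_sum R p q)).
Proof.
pose F X := 2^-1 *: (av X + (-1) ^+ sigma *: flip n_gt0 (av X)).
pose P X := 2^-1 *: (F X + (-1) ^+ iota *: regrade (F X)).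
have avl := average_linear rho (@even_set p q) (pq_signs R (p:=p) (q:=q)).
have Fl : linear F.
  by apply: linear_comb => // a X Y; rewrite avl flip_linear.
have signK (b : bool) : (-1) ^+ b * (-1) ^+ b = 1 :> R by rewrite -expr2 sqrr_sign.
rewrite /L2 (@dim_bracket _ _ _ _ n_gt0 _ P) //.
- rewrite optraceZ (optraceD F) (optraceZ _ (fun X => regrade (F X))).
  rewrite (eq_optrace (f := fun X => regrade (F X)) (g := fun X =>
    2^-1 *: (regrade (av X) + (-1) ^+ sigma *: regrade (flip n_gt0 (av X))))); last first.
    move=> X; rewrite /F /regrade -!(scalemxAr, scalemxAl) -scalerN; congr (_ *: _).
    by rewrite mulmxDr mulmxDl -!(scalemxAr, scalemxAl) opprD scalerN.
  rewrite [optrace F]optraceZ (optraceD (fun X => av X)) (optraceZ _ (fun X => flip n_gt0 (av X))).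
  rewrite (optraceZ 2^-1) (optraceD (fun X => regrade (av X))).
  rewrite (optraceZ _ (fun X => regrade (flip n_gt0 (av X)))).
  rewrite optrace_regrade_av optrace_regrade_flip_av optrace_av optrace_flip_av.
  rewrite -(card_even_set R n_gt0); have := card_D_neq0 R (even_set0 p q).
  set m := _%:R => m0; field; exact: m0.
- by apply: linear_comb => // a X Y; rewrite Fl regrade_linear.
- by move=> j /mem_J2[/mem_J1[/mem_J]].
- move=> X; have sF : so_form (F X).
    by apply: so_form_comb; [|apply: so_form_flip]; apply: so_form_average.
  have sP : so_form (P X) by apply: so_form_comb => //; apply: so_form_regrade.
  have fF : flip n_gt0 (F X) = (-1) ^+ sigma *: F X.
    by apply: sign_invol => //; [exact: flip_linear|exact: flipK].
  apply/mem_J2; split; last first.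
    by apply/has_isotropy_bracket; apply: sign_invol => //; [exact: regrade_linear|exact: regradeK].
  apply/mem_J1; split; first exact/mem_J/bracket_of_equivariant.
  apply/(has_symmetryE n_gt0) => //; rewrite /P.
  have fl := @flip_linear R p q S n_gt0.
  have f0 : flip n_gt0 (0 : 'M[R]_N) = 0.
    by have := fl (-1) 0 0; rewrite scaler0 addr0 scaleN1r addNr.
  have fZ a Y : flip n_gt0 (a *: Y) = a *: flip n_gt0 Y.
    by have := fl a Y 0; rewrite f0 !addr0.
  rewrite fZ addrC fl flip_regrade fF; move: (F X) => Y.
  have rZ : regrade ((-1) ^+ sigma *: Y) = (-1) ^+ sigma *: regrade Y.
    by rewrite /regrade -scalemxAr -scalemxAl scalerN.
  rewrite rZ [RHS]scalerA mulrC -[RHS]scalerA [(-1) ^+ sigma *: (_ + _)]scalerDr.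
  by congr (_ *: (_ + _)); rewrite !scalerA mulrC.
- move=> b ib /mem_J2[/mem_J1[_ /(has_symmetryE n_gt0 _ ib) fb] /has_isotropy_bracket rb].
  have half (c : bool) : 2^-1 *: (b + (-1) ^+ c *: ((-1) ^+ c *: b)) = b.
    by rewrite scalerA signK scale1r -mulr2n -scaler_nat scalerA mulVf ?scale1r ?pnatr_eq0.
  have Fb : F b = b by rewrite /F so_form_id // fb half.
  by rewrite /P Fb rb half.
Qed.

End Grading.
End SemispinorGrading.

(** * Reduction modulo 8 *)

(** Real and imaginary part of [(1 - i)^r i^t]. *)
Definition gauss_int (r t : nat) : int * int :=
  iter t (fun z => (- z.2, z.1)) (iter r (fun z => (z.1 + z.2, z.2 - z.1)) (1, 0)).

(** [N = dim S] is [16^m] times this number, where [n = 8 m + r] with [r < 8],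
    and [t] is [q] modulo 4; [r + 6 t] is [s = n - 2 q] modulo 8. *)
Definition size_tab (r t : nat) : nat :=
  (2 ^ r./2 * (if ((r + 6 * t) %% 8 \in [:: 0; 6; 7])%N then 1 else 2))%N.

(** Whether the volume element has square [1]. *)
Definition volume_tab (r t : nat) : bool := ~~ odd (r./2 + r + t).

(** [Im ((1 + i)^r)]. *)
Definition odd_tab (r : nat) : int := (gauss_int r (r %% 4)).2.

(** [2^r L^sigma], as given by [L1_formula]. *)
Definition L1_num (r t : nat) (sigma : bool) : int :=
  (size_tab r t)%:Z ^+ 2 + (-1) ^+ sigma * ((size_tab r t)%:Z * odd_tab r).

(** [2^(r + 1) L^(sigma iota)], as given by [L2_formula]. *)
Definition L2_num (r t : nat) (sigma iota : bool) : int :=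
  L1_num r t sigma + (-1) ^+ iota *
   (- ((~~ odd r && volume_tab r t)%:Z * (-1) ^+ t * (size_tab r t)%:Z ^+ 2) +
    (-1) ^+ sigma * ((size_tab r t)%:Z * odd_tab r)).

Definition L1_tab (r t : nat) (sigma : bool) : nat := absz (L1_num r t sigma %/ (2 ^ r)%N)%Z.
Definition L2_tab (r t : nat) (sigma iota : bool) : nat :=
  absz (L2_num r t sigma iota %/ (2 ^ r.+1)%N)%Z.

(** The criterion of [spinor_irreducible_equation], divided by [16^(2 m)]. *)
Definition irreducible_tab (r t : nat) : bool :=
  (size_tab r t)%:Z ^+ 2 + (size_tab r t)%:Z * (gauss_int r t).1 == (2 ^ r)%N.

Lemma size_tab_gt0 r t : (0 < size_tab r t)%N.
Proof. by rewrite muln_gt0 expn_gt0; case: ifP. Qed.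

Lemma all_residues (P : nat -> nat -> bool) :
  all (fun r => all (P r) (iota 0 4)) (iota 0 8) ->
  forall r t, (r < 8)%N -> (t < 4)%N -> P r t.
Proof.
by move=> h r t r8 t4; move/allP: h => /(_ r); rewrite mem_iota => /(_ r8)/allP/(_ t);
  rewrite mem_iota => /(_ t4).
Qed.

(** The table for [N] solves its equation, and the divisions above are exact; for
    [L2_num] this is only needed when [S] is reducible. *)
Lemma tables_check r t : (r < 8)%N -> (t < 4)%N ->
  [/\ (1 + (odd r && volume_tab r t))%:Z * (size_tab r t)%:Z ^+ 2 +
        (size_tab r t)%:Z * ((gauss_int r t).1 + (gauss_int r t).2) = (2 * 2 ^ r)%N,
      forall sigma, (L1_tab r t sigma)%:Z * (2 ^ r)%N = L1_num r t sigma
    & ~~ irreducible_tab r t -> forall sigma iota,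
        (L2_tab r t sigma iota)%:Z * (2 ^ r.+1)%N = L2_num r t sigma iota].
Proof.
move=> r8 t4.
have h : [&& (1 + (odd r && volume_tab r t))%:Z * (size_tab r t)%:Z ^+ 2 +
        (size_tab r t)%:Z * ((gauss_int r t).1 + (gauss_int r t).2) == (2 * 2 ^ r)%N,
      [forall sigma, (L1_tab r t sigma)%:Z * (2 ^ r)%N == L1_num r t sigma]
    & irreducible_tab r t || [forall sigma, [forall iota,
        (L2_tab r t sigma iota)%:Z * (2 ^ r.+1)%N == L2_num r t sigma iota]]].
  have fb (f : pred bool) : [forall b, f b] = f true && f false.
    by apply/forallP/andP => [h|[ht hf] []//]; split; apply: h.
  rewrite !fb; move: r t r8 t4; apply: all_residues.
  by vm_compute.
case/and3P: h => /eqP h1 /forallP h2 h3; split=> // [sigma|ir sigma iota].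
  exact/eqP.
by move: h3; rewrite (negPf ir) /= => /forallP/(_ sigma)/forallP/(_ iota)/eqP.
Qed.

Section GaussPowers.
Context (R : realType).

Lemma gauss_intE r t : (1 -i* 1)%C ^+ r * 'i%C ^+ t =
  Complex ((gauss_int r t).1%:~R : R) (gauss_int r t).2%:~R.
Proof.
rewrite /gauss_int; elim: t => [|t IH] /=.
  rewrite expr0 mulr1; elim: r => [|r IH] /=; first by rewrite expr0.
  rewrite exprS IH rmorphD rmorphB /=; apply/eqP; rewrite eq_complex /=.
  by apply/andP; split; apply/eqP; ring.
rewrite exprS mulrCA IH rmorphN /=; apply/eqP; rewrite eq_complex /=.
by apply/andP; split; apply/eqP; ring.
Qed.

Lemma gauss_powE p q : ((1 -i* 1)%C ^+ p * (1 +i* 1)%C ^+ q : R[i]) =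
  Complex (16 ^+ ((p + q) %/ 8) * (gauss_int ((p + q) %% 8) (q %% 4)).1%:~R)
          (16 ^+ ((p + q) %/ 8) * (gauss_int ((p + q) %% 8) (q %% 4)).2%:~R).
Proof.
have -> : (1 +i* 1 = (1 -i* 1) * 'i :> R[i])%C.
  by apply/eqP; rewrite eq_complex /=; apply/andP; split; apply/eqP; ring.
have e8 : (1 -i* 1)%C ^+ 8 = (16 : R)%:C%C.
  by rewrite !exprS expr0; apply/eqP; rewrite eq_complex /=; apply/andP; split; apply/eqP; ring.
have e4 : 'i%C ^+ 4 = 1 :> R[i].
  by rewrite (exprM _ 2 2) sqr_i sqrrN expr1n.
have eX (z : R[i]) k m : z ^+ m = (z ^+ k) ^+ (m %/ k) * z ^+ (m %% k).
  by rewrite -exprM mulnC -exprD -divn_eq.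
rewrite exprMn mulrA -exprD (eX _ 8 (p + q)%N) (eX 'i%C 4 q) e8 e4 expr1n mul1r.
rewrite -mulrA gauss_intE -rmorphXn.
by apply/eqP; rewrite eq_complex /=; apply/andP; split; apply/eqP; ring.
Qed.

Lemma intr_L1_num r t sigma : (L1_num r t sigma)%:~R =
  (size_tab r t)%:R ^+ 2 + (-1) ^+ sigma * ((size_tab r t)%:R * (odd_tab r)%:~R) :> R.
Proof.
rewrite /L1_num; move: (size_tab r t) (odd_tab r) => y o.
by rewrite !(rmorphD, rmorphM, rmorphXn, rmorph_sign) /= -!pmulrn.
Qed.

Lemma intr_L2_num r t sigma iota : (L2_num r t sigma iota)%:~R =
  (L1_num r t sigma)%:~R + (-1) ^+ iota *
   (- ((~~ odd r && volume_tab r t)%:R * (-1) ^+ t * (size_tab r t)%:R ^+ 2) +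
    (-1) ^+ sigma * ((size_tab r t)%:R * (odd_tab r)%:~R)) :> R.
Proof.
rewrite /L2_num; move: (L1_num _ _ _) (size_tab r t) (odd_tab r) (_ && _) => l y o c.
by rewrite !(rmorphD, rmorphN, rmorphM, rmorphXn, rmorph_sign) /= -!pmulrn.
Qed.

End GaussPowers.

Section Values.
Context (R : realType) (p q : nat) (S : spinor_module R p q).
Hypothesis n_gt0 : (0 < p + q)%N.
Local Notation N := (spinor_dim S).
Local Notation r := ((p + q) %% 8)%N.
Local Notation t := (q %% 4)%N.
Local Notation M := (16 ^+ ((p + q) %/ 8) : R).

Let M_gt0 : 0 < M. Proof. by rewrite exprn_gt0. Qed.
Let r8 : (r < 8)%N. Proof. by rewrite ltn_mod. Qed.
Let t4 : (t < 4)%N. Proof. by rewrite ltn_mod. Qed.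

Lemma odd_r : odd r = odd (p + q).
Proof. by rewrite [in RHS](divn_eq (p + q) 8) oddD oddM andbF. Qed.

Lemma pow2_M : 2 ^+ (p + q) = M ^+ 2 * (2 ^ r)%N%:R :> R.
Proof.
rewrite [in LHS](divn_eq (p + q) 8) exprD mulnC exprM natrX; congr (_ * _).
by rewrite -[RHS]exprM mulnC [RHS]exprM; congr (_ ^+ _); rewrite -!natrX.
Qed.

Lemma signr_eq1 k : ((-1) ^+ k == 1 :> R) = ~~ odd k.
Proof.
rewrite -signr_odd; case: (odd k); rewrite ?eqxx //= expr1.
by rewrite eq_sym -subr_eq0 opprK (pnatr_eq0 _ 2).
Qed.

Lemma volume_square : (cl_square R [set: 'I_(p + q)] == 1) = volume_tab r t.
Proof.
rewrite cl_squareE cardsT card_ord.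
have -> : \prod_(i in [set: 'I_(p + q)]) cl_square R [set i] = (-1) ^+ p.
  rewrite (eq_bigl predT) => [|i]; last by rewrite inE.
  rewrite big_split_ord /= [X in _ * X]big1 ?mulr1 => [|i _]; last first.
    by rewrite cl_square1 /= ltnNge leq_addr expr0.
  rewrite (eq_bigr (fun=> -1)) ?prodr_const ?card_ord // => i _.
  by rewrite cl_square1 /= ltn_ord expr1.
rewrite -exprD signr_eq1 /volume_tab oddD odd_bin2 -!oddD; congr (~~ _).
lia.
Qed.

Lemma volume_signs : pq_signs R [set: 'I_(p + q)] = (-1) ^+ t.
Proof.
rewrite /pq_signs (eq_bigl predT) => [|i]; last by rewrite inE.
rewrite big_split_ord /= [X in X * _]big1 ?mul1r => [|i _]; last first.
  by rewrite /pq_sign /= leqNgt ltn_ord expr0.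
rewrite (eq_bigr (fun=> -1)) ?prodr_const ?card_ord => [|i _]; last first.
  by rewrite /pq_sign /= leq_addr expr1.
by rewrite -signr_odd -[RHS]signr_odd; congr (_ ^+ nat_of_bool _); lia.
Qed.

Lemma spinor_dimE : N%:R = M * (size_tab r t)%:R :> R.
Proof.
have [h _ _] := tables_check r8 t4.
have := spinor_dim_equation S.
rewrite /gauss_pq gauss_powE /= /central_split volume_square -odd_r pow2_M.
have : ((1 + (odd r && volume_tab r t))%:R : R) * (size_tab r t)%:R ^+ 2 +
  (size_tab r t)%:R * ((gauss_int r t).1%:~R + (gauss_int r t).2%:~R) = 2 * (2 ^ r)%N%:R.
  have cast (c y w : nat) (a b : int) :
      (1 + c)%:Z * y%:Z ^+ 2 + y%:Z * (a + b) = (2 * w)%N ->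
      (1 + c)%:R * y%:R ^+ 2 + y%:R * (a%:~R + b%:~R) = 2 * w%:R :> R.
    move=> /(congr1 (fun z : int => z%:~R : R)).
    by rewrite PoszM !(rmorphD, rmorphM, rmorphXn) /= -!pmulrn => ->.
  exact: cast.
have N0 : 0 < N%:R :> R by rewrite ltr0n spinor_dim_gt0.
have w0 : 0 < (2 ^ r)%N%:R :> R by rewrite ltr0n expn_gt0.
have y0 : 0 < (size_tab r t)%:R :> R by rewrite ltr0n size_tab_gt0.
rewrite natrD; set c := (_ && _)%:R; set a := _%:~R; set b := _%:~R.
have c0 : 0 <= c :> R by rewrite ler0n.
move: (N%:R) (size_tab r t)%:R (2 ^ r)%N%:R M M_gt0 c0 N0 w0 y0 => x y w m m0 c0 x0 w0 y0 hy hx.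
have y'0 : 0 < m * y by rewrite mulr_gt0.
have e1 : (1 + c) * (m * y) ^+ 2 + m * y * (m * a + m * b) = 2 * (m ^+ 2 * w).
  transitivity (m ^+ 2 * (2 * w)); last by ring.
  rewrite -hy; ring.
(* [x = N] and [m * y] are both positive roots of the same quadratic equation,
   whose product of roots is negative. *)
have : (x - m * y) * ((1 + c) * (x + m * y) + (m * a + m * b)) = 0.
  rewrite -[RHS](subrr (2 * (m ^+ 2 * w))) -{1}hx -e1; ring.
move/eqP; rewrite mulf_eq0 subr_eq0 => /orP[/eqP//|/eqP h0].
have : x * ((1 + c) * x + (m * a + m * b)) = 2 * (m ^+ 2 * w) by rewrite -hx; ring.
have -> : (1 + c) * x + (m * a + m * b) = - ((1 + c) * (m * y)) by lra.
have : 0 < x * ((1 + c) * (m * y)) by rewrite !mulr_gt0 // ltr_wpDr.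
have : 0 < m ^+ 2 * w by rewrite mulr_gt0 // exprn_gt0.
lra.
Qed.

Lemma irreducibleE : ~ spinor_reducible S <-> irreducible_tab r t.
Proof.
rewrite spinor_irreducible_equation // /gauss_pq gauss_powE /= spinor_dimE pow2_M.
have -> : (M * (size_tab r t)%:R) ^+ 2 + M * (size_tab r t)%:R * (M * (gauss_int r t).1%:~R) =
   M ^+ 2 * ((size_tab r t)%:Z ^+ 2 + (size_tab r t)%:Z * (gauss_int r t).1)%:~R.
  rewrite rmorphD rmorphM rmorphXn /= -!pmulrn; ring.
have M2 : M ^+ 2 != 0 by rewrite expf_neq0 // gt_eqF.
split=> [/(mulfI M2)/eqP|/eqP ->]; last by rewrite -pmulrn.
by rewrite pmulrn eqr_int.
Qed.

Lemma odd_sumE : odd_sum R p q = M * (odd_tab r)%:~R.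
Proof.
have := gauss_powE R 0 (p + q); rewrite expr0 mul1r add0n /odd_sum => ->/=.
by rewrite /odd_tab; congr (_ * (gauss_int _ _).2%:~R); lia.
Qed.

Lemma L1E sigma : L1 S sigma = L1_tab r t sigma.
Proof.
have [_ h _] := tables_check r8 t4.
have := L1_formula S n_gt0 sigma; rewrite odd_sumE spinor_dimE pow2_M.
have -> : (M * (size_tab r t)%:R) ^+ 2 +
    (-1) ^+ sigma * (M * (size_tab r t)%:R * (M * (odd_tab r)%:~R)) =
    M ^+ 2 * (L1_num r t sigma)%:~R.
  by rewrite intr_L1_num; ring.
rewrite -h mulrCA rmorphM /= -!pmulrn => e.
have M2 : M ^+ 2 != 0 by rewrite expf_neq0 // gt_eqF.
have w2 : (2 ^ r)%N%:R != 0 :> R by rewrite pnatr_eq0 expn_eq0.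
by move/(mulfI M2)/(mulIf w2)/eqP: e; rewrite eqr_nat => /eqP.
Qed.

Lemma L2E Sp Sm sigma iota : spinor_reducible S -> semispinors S Sp Sm ->
  L2 S Sp Sm sigma iota = L2_tab r t sigma iota.
Proof.
move=> red /semispinors_grading[E gE].
have [_ _ h] := tables_check r8 t4.
have {}h : (L2_tab r t sigma iota)%:Z * (2 ^ r.+1)%N = L2_num r t sigma iota.
  by apply: h; apply/negP => /irreducibleE; apply.
have := L2_formula n_gt0 gE sigma iota.
rewrite odd_sumE (grading_sumE gE) spinor_dimE volume_square volume_signs -odd_r pow2_M.
set c := _ && _.
have -> : (M * (size_tab r t)%:R) ^+ 2 +
    (-1) ^+ sigma * (M * (size_tab r t)%:R * (M * (odd_tab r)%:~R)) +
    (-1) ^+ iota * (- (c%:R * (-1) ^+ t * (M * (size_tab r t)%:R) ^+ 2) +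
    (-1) ^+ sigma * (M * (size_tab r t)%:R * (M * (odd_tab r)%:~R))) =
    M ^+ 2 * (L2_num r t sigma iota)%:~R.
  by rewrite intr_L2_num intr_L1_num -/c; ring.
rewrite -h (mulrCA 2) [LHS]mulrCA rmorphM /= -!pmulrn expnS natrM => e.
have M2 : M ^+ 2 != 0 by rewrite expf_neq0 // gt_eqF.
have w2 : 2 * (2 ^ r)%N%:R != 0 :> R by rewrite mulf_neq0 ?pnatr_eq0 // expn_eq0.
by move/(mulfI M2)/(mulIf w2)/eqP: e; rewrite eqr_nat => /eqP.
Qed.

End Values.

(** * The tables *)

(** The values of [(L^+, L^-)] and of [(L^(++), L^(+-), L^(-+), L^(--))] as functions
    of [n] modulo 8 and [q] modulo 4. *)
Definition pair_tab (r t : nat) : nat * nat := (L1_tab r t false, L1_tab r t true).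

Definition quad_tab (r t : nat) : nat * nat * nat * nat :=
  (L2_tab r t false false, L2_tab r t false true,
   L2_tab r t true false, L2_tab r t true true).

(** [n] and [s] modulo 8 determine [q = (n - s) / 2] modulo 4. *)
Lemma mod8_residues p q (n s : int) : mod8 p q n s ->
  ((p + q) %% 8)%N = absz (n %% 8)%Z /\ (q %% 4)%N = absz (((n - s)%R %/ 2)%Z %% 4)%Z.
Proof. rewrite /mod8; lia. Qed.

(** Replacing [n] by [- n] with [s] fixed replaces [q] by [q - n]. *)
Lemma mirror_tab r t : (r < 8)%N -> (t < 4)%N ->
  L1_tab ((8 - r) %% 8) ((t + 8 - r) %% 4) false = L1_tab r t true.
Proof.
move=> r8 t4; apply/eqP; move: r t r8 t4; apply: all_residues.
by vm_compute.
Qed.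

Lemma mirror_quad_tab r t iota : (r < 8)%N -> (t < 4)%N -> ~~ irreducible_tab r t ->
  L2_tab ((8 - r) %% 8) ((t + 8 - r) %% 4) false iota = L2_tab r t true iota.
Proof.
move=> r8 t4 red; apply/eqP; move: red; apply/implyP; move: r t r8 t4.
by case: iota; apply: all_residues; vm_compute.
Qed.

Lemma irreducible_tabE r t : (r < 8)%N -> (t < 4)%N ->
  ~~ irreducible_tab r t = ((r + 6 * t) %% 8 \in [:: 4; 2; 1; 0])%N.
Proof.
pose P r t := ~~ irreducible_tab r t == ((r + 6 * t) %% 8 \in [:: 4; 2; 1; 0])%N.
move=> r8 t4; suff /eqP : P r t by []; move: r t r8 t4; apply: all_residues.
by vm_compute.
Qed.

Lemma sum_tab r t sigma : (r < 8)%N -> (t < 4)%N -> ~~ irreducible_tab r t ->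
  L1_tab r t sigma = (L2_tab r t sigma false + L2_tab r t sigma true)%N.
Proof.
move=> r8 t4 red; apply/eqP; move: red; apply/implyP; move: r t r8 t4.
by case: sigma; apply: all_residues; vm_compute.
Qed.

Section Tables.
Context (R : realType) (p q : nat) (S : spinor_module R p q).
Hypothesis n_gt0 : (0 < p + q)%N.
Local Notation r := ((p + q) %% 8)%N.
Local Notation t := (q %% 4)%N.

Lemma reducibleE : spinor_reducible S <-> ~~ irreducible_tab r t.
Proof.
have := irreducibleE S n_gt0; case: irreducible_tab => h.
  by split=> // /(h.2 isT).
by split=> // _; apply: contrapT => /h.
Qed.

Lemma L_pairE : L_pair S = pair_tab r t.
Proof. by rewrite /L_pair !L1E. Qed.

Lemma L_quadE Sp Sm : spinor_reducible S -> semispinors S Sp Sm ->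
  L_quad S Sp Sm = quad_tab r t.
Proof. by move=> red ss; rewrite /L_quad !L2E. Qed.

Lemma L_pair_mod8 n s : mod8 p q n s ->
  L_pair S = pair_tab (absz (n %% 8)%Z) (absz (((n - s)%R %/ 2)%Z %% 4)%Z).
Proof. by rewrite L_pairE => /mod8_residues[-> ->]. Qed.

Lemma L_quad_mod8 Sp Sm n s : spinor_reducible S -> semispinors S Sp Sm ->
  mod8 p q n s ->
  L_quad S Sp Sm = quad_tab (absz (n %% 8)%Z) (absz (((n - s)%R %/ 2)%Z %% 4)%Z).
Proof. by move=> red ss; rewrite L_quadE // => /mod8_residues[-> ->]. Qed.

Lemma spinor_reducible_mod8 : spinor_reducible S <->
  [\/ (p%:Z - q%:Z = 4 %[mod 8])%Z, (p%:Z - q%:Z = 2 %[mod 8])%Z,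
      (p%:Z - q%:Z = 1 %[mod 8])%Z | (p%:Z - q%:Z = 0 %[mod 8])%Z].
Proof.
rewrite reducibleE irreducible_tabE ?ltn_mod //.
have -> : ((r + 6 * t) %% 8)%N = absz ((p%:Z - q%:Z)%R %% 8)%Z by lia.
rewrite !inE; split=> [/or4P[] /eqP h|[] h].
- by apply: Or41; lia.
- by apply: Or42; lia.
- by apply: Or43; lia.
- by apply: Or44; lia.
- by apply/or4P/Or41; lia.
- by apply/or4P/Or42; lia.
- by apply/or4P/Or43; lia.
- by apply/or4P/Or44; lia.
Qed.

End Tables.

Unset Implicit Arguments.
Set Strict Implicit.
Set Printing Implicit Defensive.

Theorem theorem6p4 (R : realType) :
  (forall (p q p' q' : nat) (S : spinor_module R p q) (S' : spinor_module R p' q'),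
    (1 <= p + q)%N -> (1 <= p' + q')%N ->
    mod8 p' q' (p%:Z + q%:Z) (p%:Z - q%:Z) ->
    L_pair S' = L_pair S /\
    (spinor_reducible S -> spinor_reducible S' ->
      forall Sp Sm Sp' Sm', semispinors S Sp Sm -> semispinors S' Sp' Sm' ->
      L_quad S' Sp' Sm' = L_quad S Sp Sm)) /\
  (forall (p q p' q' : nat) (S : spinor_module R p q) (S' : spinor_module R p' q'),
    (1 <= p + q)%N -> (1 <= p' + q')%N ->
    mod8 p' q' (- (p%:Z + q%:Z)) (p%:Z - q%:Z) ->
    L1 S' false = L1 S true /\
    (spinor_reducible S -> spinor_reducible S' ->
      forall Sp Sm Sp' Sm', semispinors S Sp Sm -> semispinors S' Sp' Sm' ->
      forall iota : bool, L2 S' Sp' Sm' false iota = L2 S Sp Sm true iota)) /\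
  (forall (p q : nat) (S : spinor_module R p q), (1 <= p + q)%N ->
    (spinor_reducible S <->
      [\/ (p%:Z - q%:Z = 4 %[mod 8])%Z, (p%:Z - q%:Z = 2 %[mod 8])%Z,
          (p%:Z - q%:Z = 1 %[mod 8])%Z | (p%:Z - q%:Z = 0 %[mod 8])%Z]) /\
    (spinor_reducible S -> forall Sp Sm, semispinors S Sp Sm ->
      (mod8 p q (-2) 4 -> L_quad S Sp Sm = (2, 0, 6, 0)%N) /\
      (mod8 p q 0 4 -> L_quad S Sp Sm = (0, 4, 0, 4)%N) /\
      (mod8 p q 2 4 -> L_quad S Sp Sm = (6, 0, 2, 0)%N) /\
      (mod8 p q 4 4 -> L_quad S Sp Sm = (0, 4, 0, 4)%N) /\
      (mod8 p q (-2) 2 -> L_quad S Sp Sm = (0, 2, 4, 2)%N) /\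
      (mod8 p q 0 2 -> L_quad S Sp Sm = (2, 2, 2, 2)%N) /\
      (mod8 p q 2 2 -> L_quad S Sp Sm = (4, 2, 0, 2)%N) /\
      (mod8 p q 4 2 -> L_quad S Sp Sm = (2, 2, 2, 2)%N) /\
      (mod8 p q (-3) 1 -> L_quad S Sp Sm = (0, 1, 2, 1)%N) /\
      (mod8 p q (-1) 1 -> L_quad S Sp Sm = (0, 1, 2, 1)%N) /\
      (mod8 p q 1 1 -> L_quad S Sp Sm = (2, 1, 0, 1)%N) /\
      (mod8 p q 3 1 -> L_quad S Sp Sm = (2, 1, 0, 1)%N) /\
      (mod8 p q (-2) 0 -> L_quad S Sp Sm = (0, 0, 2, 0)%N) /\
      (mod8 p q 0 0 -> L_quad S Sp Sm = (0, 1, 0, 1)%N) /\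
      (mod8 p q 2 0 -> L_quad S Sp Sm = (2, 0, 0, 0)%N) /\
      (mod8 p q 4 0 -> L_quad S Sp Sm = (0, 1, 0, 1)%N)) /\
    (~ spinor_reducible S ->
      (mod8 p q (-3) 3 -> L_pair S = (1, 3)%N) /\
      (mod8 p q (-1) 3 -> L_pair S = (1, 3)%N) /\
      (mod8 p q 1 3 -> L_pair S = (3, 1)%N) /\
      (mod8 p q 3 3 -> L_pair S = (3, 1)%N) /\
      (mod8 p q (-3) (-1) -> L_pair S = (0, 1)%N) /\
      (mod8 p q (-1) (-1) -> L_pair S = (0, 1)%N) /\
      (mod8 p q 1 (-1) -> L_pair S = (1, 0)%N) /\
      (mod8 p q 3 (-1) -> L_pair S = (1, 0)%N) /\
      (mod8 p q (-2) (-2) -> L_pair S = (0, 2)%N) /\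
      (mod8 p q 0 (-2) -> L_pair S = (1, 1)%N) /\
      (mod8 p q 2 (-2) -> L_pair S = (2, 0)%N) /\
      (mod8 p q 4 (-2) -> L_pair S = (1, 1)%N) /\
      (mod8 p q (-3) (-3) -> L_pair S = (1, 3)%N) /\
      (mod8 p q (-1) (-3) -> L_pair S = (1, 3)%N) /\
      (mod8 p q 1 (-3) -> L_pair S = (3, 1)%N) /\
      (mod8 p q 3 (-3) -> L_pair S = (3, 1)%N)) /\
    (spinor_reducible S -> forall Sp Sm, semispinors S Sp Sm ->
      forall sigma : bool,
        L1 S sigma = (L2 S Sp Sm sigma false + L2 S Sp Sm sigma true)%N)).

Proof.
split; [|split].
- move=> p q p' q' S S' n0 n0' /mod8_residues[er et].
  have {}er : ((p' + q') %% 8 = (p + q) %% 8)%N by lia.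
  have {}et : (q' %% 4 = q %% 4)%N by lia.
  split; first by rewrite !L_pairE // er et.
  by move=> red red' Sp Sm Sp' Sm' ss ss'; rewrite !L_quadE // er et.
- move=> p q p' q' S S' n0 n0' /mod8_residues[er et].
  have {}er : ((p' + q') %% 8 = (8 - (p + q) %% 8) %% 8)%N by lia.
  have {}et : (q' %% 4 = (q %% 4 + 8 - (p + q) %% 8) %% 4)%N by lia.
  split; first by rewrite !L1E // er et mirror_tab // ltn_mod.
  move=> red red' Sp Sm Sp' Sm' ss ss' iota; rewrite !L2E // er et.
  by rewrite mirror_quad_tab ?ltn_mod //; apply/(reducibleE S n0).
- move=> p q S n0; split; [exact: spinor_reducible_mod8|split; [|split]].
  + move=> red Sp Sm ss; have L n s := @L_quad_mod8 R p q S n0 Sp Sm n s red ss.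
    by do 15?[split; first by move=> /L ->; vm_compute]; move=> /L ->; vm_compute.
  + move=> _; have L n s := @L_pair_mod8 R p q S n0 n s.
    by do 15?[split; first by move=> /L ->; vm_compute]; move=> /L ->; vm_compute.
  + move=> red Sp Sm ss sigma; rewrite L1E // !L2E //.
    by apply: sum_tab; rewrite ?ltn_mod //; apply/(reducibleE S n0).
Qed.
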